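(* For every fixed $d\in\mathbb N$, $$\lim_{n\to\infty}\frac{\boldsymbol\lambda\bigl(\mathcal T_d(\ell_\infty^n(\mathbb C))\bigr)}{\sqrt{\binom nd}}=\frac{\Gamma\bigl(1+\frac d2\bigr)}{\sqrt{d!}}.$$ Equivalently, $$\lim_{n\to\infty}\frac{\boldsymbol\lambda\bigl(\mathcal T_d(\ell_\infty^n(\mathbb C))\bigr)}{n^{d/2}}=\frac{\Gamma\bigl(1+\frac d2\bigr)}{d!}.$$
   Context: $\ell_\infty^n(\mathbb C)=(\mathbb C^n,\|\cdot\|_\infty)$. $\mathcal T_d(\ell_\infty^n(\mathbb C))$ is the complex Banach space of tetrahedral $d$-homogeneous polynomials $P(z)=\sum_{A\subset\{1,\ldots,n\},|A|=d}c_A\prod_{j\in A}z_j$ ($c_A\in\mathbb C$), with norm $\|P\|=\sup_{\|z\|_\infty\le1}|P(z)|$. Projection constants: for a subspace $X$ of a Banach space $Y$, $\boldsymbol\lambda(X,Y)=\inf\{\|P\|: P\in\mathcal L(Y),\ P^2=P,\ P(Y)=X\}$; $\boldsymbol\lambda(X)=\sup_Y\boldsymbol\lambda(X,Y)$ over all Banach spaces $Y$ containing $X$ isometrically. *)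

(* Defs.v *)
From HB Require Import structures.
From mathcomp Require Import all_boot all_order all_algebra.
From mathcomp Require Import complex.
From mathcomp Require Import all_classical all_reals all_analysis.

Set Implicit Arguments.
Unset Strict Implicit.
Unset Printing Implicit Defensive.

Import Order.TTheory GRing.Theory Num.Theory.
Import Normc.
Import numFieldNormedType.Exports.

Local Open Scope classical_set_scope.
Local Open Scope ring_scope.
Local Open Scope complex_scope.

(* The norm of a [normedModType R[i]] is [R[i]]-valued; being nonnegative, it is
   equal to its real part. *)
Definition op_norm (R : realType) (V W : normedModType R[i]) (f : V -> W) :
    \bar R :=
  ereal_sup [set (complex.Re `|f v|)%:E | v in [set v : V | `|v| <= 1]].

Definition rel_proj_const (R : realType) (Y : completeNormedModType R[i])
    (X : set Y) : \bar R :=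
  ereal_inf [set op_norm (P : Y -> Y) | P in [set P : {linear Y -> Y} |
    [/\ continuous P, forall y, P (P y) = P y & range P = X]]].

(* A Banach space containing [X] isometrically is a Banach space [Y] with a
   linear isometric embedding [j : X -> Y]; [X] is identified with its image. *)
Definition proj_const (R : realType) (X : normedModType R[i]) : \bar R :=
  ereal_sup [set l | exists (Y : completeNormedModType R[i])
    (j : {linear X -> Y}),
    (forall x, `|j x| = `|x|) /\ l = rel_proj_const (range j)].

(* A tetrahedral [d]-homogeneous polynomial in [n] variables is represented by
   its family of coefficients [c_A], where [A] ranges over the subsets of
   ['I_n] of cardinality [d]. *)
Definition tetra (R : realType) (n d : nat) : Type :=
  {ffun {A : {set 'I_n} | #|A| == d} -> R[i]}.

Definition tetra_coef (R : realType) (n d : nat) (P : tetra R n d) :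
  {ffun {A : {set 'I_n} | #|A| == d} -> R[i]} := P.

HB.instance Definition _ (R : realType) (n d : nat) :=
  GRing.Lmodule.copy (tetra R n d)
    {ffun {A : {set 'I_n} | #|A| == d} -> R[i]}.

Definition tetra_eval (R : realType) (n d : nat) (P : tetra R n d)
    (z : 'rV[R[i]]_n) : R[i] :=
  \sum_(A : {A : {set 'I_n} | #|A| == d})
    tetra_coef P A * \prod_(j in val A) z ord0 j.

(* [`|z|] is the sup norm on ['rV[R[i]]_n]; [normc] is the real-valued modulus. *)
Definition tetra_norm (R : realType) (n d : nat) (P : tetra R n d) : R :=
  sup [set normc (tetra_eval P z) | z in [set z : 'rV[R[i]]_n | `|z| <= 1]].

Section tetra_normed.
Context (R : realType) (n d : nat).
Implicit Types (P Q : tetra R n d) (z : 'rV[R[i]]_n).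

Lemma tetra_evalD P Q z :
  tetra_eval (P + Q) z = tetra_eval P z + tetra_eval Q z.
Proof.
rewrite /tetra_eval -big_split; apply: eq_bigr => A _ /=.
by rewrite -mulrDl /tetra_coef ffunE.
Qed.

Lemma tetra_evalZ (a : R[i]) P z :
  tetra_eval (a *: P) z = a * tetra_eval P z.
Proof.
rewrite /tetra_eval mulr_sumr; apply: eq_bigr => A _.
by rewrite mulrA /tetra_coef ffunE.
Qed.

Lemma rV_norm_le1 z : `|z| <= 1 <-> forall j, `|z ord0 j| <= 1.
Proof.
rewrite [`|z|]mx_normE -[1]nngE num_le; split.
  move=> /bigmax_leP[_ h] j; have := h (ord0, j) isT.
  by rewrite -num_le.
move=> h; apply/bigmax_leP; split => [|[i j] _]; rewrite -num_le //= ?ler01//.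
by rewrite ord1.
Qed.

Let le_complex (x y : R) : (x%:C <= y%:C) = (x <= y).
Proof. by rewrite lecE /= eqxx. Qed.

Lemma tetra_eval_le P z : `|z| <= 1 ->
  normc (tetra_eval P z) <= \sum_A normc (tetra_coef P A).
Proof.
move=> /rV_norm_le1 z1.
rewrite -le_complex rmorph_sum -[(normc _)%:C]/(`|tetra_eval P z|).
apply: le_trans (ler_norm_sum _ _ _) _.
apply: ler_sum => A _; rewrite normrM normr_prod.
by apply: ler_piMr => //; apply: prodr_ile1 => j _; rewrite normr_ge0 z1.
Qed.

Lemma tetra_norm_has_sup P : has_sup
  [set normc (tetra_eval P z) | z in [set z : 'rV[R[i]]_n | `|z| <= 1]].
Proof.
split.
  by exists (normc (tetra_eval P 0)), 0 => //=; rewrite normr0 ler01.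
exists (\sum_A normc (tetra_coef P A)) => _ [z z1 <-]; exact: tetra_eval_le.
Qed.

Lemma tetra_norm_ub P z : `|z| <= 1 -> normc (tetra_eval P z) <= tetra_norm P.
Proof.
by move=> z1; apply: (sup_upper_bound (tetra_norm_has_sup P)); exists z.
Qed.

Lemma tetra_norm_lub P (x : R) :
  (forall z, `|z| <= 1 -> normc (tetra_eval P z) <= x) -> tetra_norm P <= x.
Proof.
move=> h; apply: ge_sup; first by case: (tetra_norm_has_sup P).
by move=> _ [z z1 <-]; exact: h.
Qed.

Let normc_ge0 (x : R[i]) : 0 <= normc x.
Proof. by case: x => a b; exact: sqrtr_ge0. Qed.

Lemma tetra_norm_ge0 P : 0 <= tetra_norm P.
Proof.
by apply: le_trans (tetra_norm_ub P (z := 0) _) => //; rewrite normr0 ler01.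
Qed.

Lemma tetra_normD P Q :
  (tetra_norm (P + Q))%:C <= (tetra_norm P)%:C + (tetra_norm Q)%:C.
Proof.
rewrite -rmorphD le_complex; apply: tetra_norm_lub => z z1.
rewrite tetra_evalD; apply: le_trans (le_normcD _ _) _.
by apply: lerD; exact: tetra_norm_ub.
Qed.

Lemma tetra_normZ (a : R[i]) P :
  (tetra_norm (a *: P))%:C = `|a| * (tetra_norm P)%:C.
Proof.
have le_normZ (b : R[i]) Q : tetra_norm (b *: Q) <= normc b * tetra_norm Q.
  apply: tetra_norm_lub => z z1; rewrite tetra_evalZ normcM.
  by apply: ler_wpM2l => //; exact: tetra_norm_ub.
have -> : `|a| * (tetra_norm P)%:C = (normc a * tetra_norm P)%:C.
  by rewrite rmorphM.
congr (_%:C); apply/eqP; rewrite eq_le le_normZ /=.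
have [->|a0] := eqVneq a 0; first by rewrite normc0 mul0r tetra_norm_ge0.
have na0 : normc a != 0 by apply: contra a0 => /eqP/eq0_normc/eqP.
have := le_normZ a^-1 (a *: P); rewrite scalerA mulVf// scale1r normcV.
by rewrite ler_pdivlMl // lt_def na0 normc_ge0.
Qed.

Lemma tetra_norm_eq0 P : (tetra_norm P)%:C = 0 -> P = 0.
Proof.
move=> [P0]; apply/ffunP => A; rewrite [RHS]ffunE.
pose z : 'rV[R[i]]_n := \row_j (j \in val A)%:R.
have z1 : `|z| <= 1.
  apply/rV_norm_le1 => j; rewrite mxE.
  by case: (j \in _); rewrite ?normr1 ?normr0 ?ler01.
suff <- : tetra_eval P z = P A.
  apply: eq0_normc; apply/eqP; rewrite eq_le normc_ge0 andbT -[leRHS]P0.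
  exact: tetra_norm_ub.
rewrite /tetra_eval (bigD1 A)//= big1 ?mulr1; last first.
  by move=> j jA; rewrite mxE jA.
rewrite big1 ?addr0// => B BA.
have /subsetPn[j jB jA] : ~~ (val B \subset val A).
  apply: contra BA => BA; apply/eqP/val_inj/eqP.
  by rewrite eqEcard BA (eqP (valP A)) (eqP (valP B)) leqnn.
by rewrite (bigD1 j)//= mxE (negbTE jA) mul0r mulr0.
Qed.

End tetra_normed.

HB.instance Definition _ (R : realType) (n d : nat) :=
  Lmodule_isNormed.Build R[i] (tetra R n d)
    (@tetra_normD R n d) (@tetra_normZ R n d) (@tetra_norm_eq0 R n d).

Definition Gamma (R : realType) (x : R) : R :=
  Rintegral lebesgue_measure `]0, +oo[%classic
    (fun t : R => t `^ (x - 1) * expR (- t)).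

(* Main.v *)
(* Since [T_d] is spanned by characters of the torus, its projection constant is
   the [L^1]-norm of its Dirichlet kernel, which is the elementary symmetric
   polynomial [e_d].  Haar measure is replaced by the uniform measure on
   [n]-tuples of [N]-th roots of unity.
   Upper bound: extend the evaluations at these tuples by Hahn-Banach and
   convolve with [e_d]; for fixed [N] the resulting norm is a supremum over
   [z] in the torus of [E |e_d (z zeta)|].
   Lower bound: embed [T_d] in the bounded functions on the torus, average a
   projection over the tuples and test it on [h = e_d / (|e_d| + k)]; as [N]
   grows, the Fourier coefficients of [h] over cosets of the tuples become
   independent of the coset.
   Asymptotics, uniformly in [N >= 3] and [z]: [d! e_d] is the [d]-th power of
   the sum of the [z_j zeta_j] up to a term of lower order in [L^1], and the
   normalized sum [S] is asymptotically complex Gaussian.  A Lindeberg argument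
   along the explicit heat flow of [exp (- s |x|^2)] gives
   [E exp (- k |S|^2) --> 1 / (1 + k)] for integers [k]; these are the moments
   of [exp (- t)] under [exp (- t) dt] on the half-line, so the Weierstrass
   theorem applied to [y = exp (- t)] gives
   [E |S|^d --> \int t^(d/2) exp (- t) dt = Gamma (1 + d/2)]. *)
Require Import Defs.
From HB Require Import structures.
From mathcomp Require Import all_boot all_order all_algebra.
From mathcomp Require Import complex.
From mathcomp Require Import ring lra.
From mathcomp Require Import all_classical all_reals all_analysis.
From mathcomp Require Import measurable_realfun.
Set Implicit Arguments.
Unset Strict Implicit.
Unset Printing Implicit Defensive.
Import Order.TTheory GRing.Theory Num.Theory.
Import Normc.
Import numFieldNormedType.Exports.
Local Open Scope classical_set_scope.
Local Open Scope ring_scope.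
Local Open Scope complex_scope.

(** * Complex modulus *)

(** The projection constant involves arbitrary superspaces, functionals and projections, so every
    average is a finite one and no vector-valued integral occurs. The price is that the finite group
    does not exhaust the torus: the upper bound keeps a supremum over cosets, and the lower bound
    needs an N depending on n and on the tolerance. This is why all asymptotic estimates have to be
    uniform in N and in the coset point z. Order at least 3 gives this uniformity: a random root
    zeta then satisfies E zeta = E zeta^2 = 0 and E |zeta|^2 = 1, the moments up to order two of a
    standard complex Gaussian, and monomials with one squared variable remain orthogonal. The
    smoothing k in h replaces the sign of e_d, discontinuous at the zeros of e_d, by a Lipschitz
    function, so that a small rotation changes Fourier coefficients little. Since |S|^d is
    unbounded, polynomials in exp (- |S|^2) approximate it only up to a multiple of 1 + |S|^(d+1);
    this error is paid for by moments of order d + 1, of S through exponential moments and of the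
    limit law directly. *)

Section ComplexModulus.
Context (R : realType).
Implicit Types (x y : R[i]) (a b : R).

Definition cabs x : R := normc x.

Lemma cabsE x : `|x| = (cabs x)%:C. Proof. by []. Qed.

Lemma ler_complex a b : (a%:C <= b%:C) = (a <= b).
Proof. by rewrite lecE /= eqxx. Qed.

Lemma cabs_ge0 x : 0 <= cabs x.
Proof. by case: x => a b; exact: sqrtr_ge0. Qed.

Lemma cabsM x y : cabs (x * y) = cabs x * cabs y.
Proof. exact: normcM. Qed.

Lemma cabsD x y : cabs (x + y) <= cabs x + cabs y.
Proof. exact: le_normcD. Qed.

Lemma cabsN x : cabs (- x) = cabs x.
Proof. exact: normcN. Qed.

Lemma cabsB x y : cabs (x - y) = cabs (y - x).
Proof. by rewrite -cabsN opprB. Qed.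

Lemma cabs_tri z x y : cabs (x - y) <= cabs (x - z) + cabs (z - y).
Proof. by rewrite -[x - y](subrKA z); exact: cabsD. Qed.

Lemma cabs0 : cabs 0 = 0.
Proof. exact: normc0. Qed.

Lemma cabs1 : cabs 1 = 1.
Proof. exact: normc1. Qed.

Lemma cabsV x : cabs x^-1 = (cabs x)^-1.
Proof. exact: normcV. Qed.

Lemma cabsX x n : cabs (x ^+ n) = cabs x ^+ n.
Proof. by elim: n => [|n IH]; rewrite ?expr0 ?cabs1// !exprS cabsM IH. Qed.

Lemma cabs_eq0 x : (cabs x == 0) = (x == 0).
Proof. by apply/eqP/eqP => [/eq0_normc//|->]; rewrite cabs0. Qed.

Lemma cabs_sqr x : cabs x ^+ 2 = complex.Re x ^+ 2 + complex.Im x ^+ 2.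
Proof. by case: x => a b; rewrite /cabs /= sqr_sqrtr// addr_ge0 ?sqr_ge0. Qed.

Lemma cabsJ x : cabs x^* = cabs x.
Proof. by case: x => a b; rewrite /cabs /= sqrrN. Qed.

Lemma cabs_real a : cabs a%:C = `|a|.
Proof. by rewrite /cabs /= expr0n /= addr0 sqrtr_sqr. Qed.

Lemma cabs_nat n : cabs n%:R = n%:R.
Proof. by rewrite -(rmorph_nat (real_complex R)) cabs_real ger0_norm. Qed.

Lemma cabs_sum (I : Type) (r : seq I) (P : pred I) (F : I -> R[i]) :
  cabs (\sum_(i <- r | P i) F i) <= \sum_(i <- r | P i) cabs (F i).
Proof.
elim/big_rec2: _ => [|i u v _ h]; first by rewrite cabs0.
by apply: le_trans (cabsD _ _) _; rewrite lerD2l.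
Qed.

Lemma cabs_prod (I : Type) (r : seq I) (P : pred I) (F : I -> R[i]) :
  cabs (\prod_(i <- r | P i) F i) = \prod_(i <- r | P i) cabs (F i).
Proof. exact: (big_morph cabs cabsM cabs1). Qed.

Lemma ReD x y : complex.Re (x + y) = complex.Re x + complex.Re y.
Proof. by case: x y => [a b] [c e]. Qed.

Lemma ReZ a y : complex.Re (a%:C * y) = a * complex.Re y.
Proof. by case: y => c e; rewrite /= mul0r subr0. Qed.

Lemma normr_Re_le x : `|complex.Re x| <= cabs x.
Proof.
rewrite -[leRHS]ger0_norm ?cabs_ge0// -ler_sqr ?nnegrE// !real_normK ?num_real//.
by rewrite cabs_sqr lerDl sqr_ge0.
Qed.

Lemma normr_Im_le x : `|complex.Im x| <= cabs x.
Proof.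
rewrite -[leRHS]ger0_norm ?cabs_ge0// -ler_sqr ?nnegrE// !real_normK ?num_real//.
by rewrite cabs_sqr lerDr sqr_ge0.
Qed.

Lemma Re_le_cabs x : complex.Re x <= cabs x.
Proof. exact: le_trans (ler_norm _) (normr_Re_le _). Qed.

Lemma cabs_le_ReIm x a b :
  `|complex.Re x| <= a -> `|complex.Im x| <= b -> cabs x <= a + b.
Proof.
move=> xa xb; have a0 := le_trans (normr_ge0 _) xa.
have b0 := le_trans (normr_ge0 _) xb.
rewrite -ler_sqr ?nnegrE ?addr_ge0 ?cabs_ge0// cabs_sqr sqrrD.
rewrite -[leLHS]addr0 -(real_normK (num_real (complex.Re x))).
rewrite -(real_normK (num_real (complex.Im x))) addrAC -addrA addrA.
by rewrite !lerD// ?mulrn_wge0 ?mulr_ge0// lerXn2r ?nnegrE.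
Qed.

Lemma lerB_cabs x y : `|cabs x - cabs y| <= cabs (x - y).
Proof.
rewrite ler_norml; apply/andP; split.
  by rewrite lerNl opprB lerBlDr cabsB -[in leLHS](subrK x y) cabsD.
by rewrite lerBlDr -[in leLHS](subrK y x) cabsD.
Qed.

Lemma mulr_conj x : x * x^* = (cabs x ^+ 2)%:C.
Proof. by rewrite -sqr_normc cabsE rmorphXn. Qed.

Lemma cabs_phase x : exists2 u, cabs u = 1 & u * x = (cabs x)%:C.
Proof.
have [->|x0] := eqVneq x 0; first by exists 1; rewrite ?cabs1// mulr0 cabs0.
have c0 : cabs x != 0 by rewrite cabs_eq0.
exists (x^* / (cabs x)%:C).
  by rewrite cabsM cabsV cabs_real ger0_norm ?cabs_ge0// cabsJ divff.
rewrite mulrAC [_ * x]mulrC mulr_conj -rmorphV ?unitfE// -rmorphM/=.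
by rewrite expr2 mulfK.
Qed.

End ComplexModulus.

(** * Hahn-Banach extension *)

Section HahnBanach.
Context (R : realType) (Y : lmodType R[i]) (p : Y -> R).
Hypothesis pD : forall x y, p (x + y) <= p x + p y.
Hypothesis pZ : forall a x, p (a *: x) = cabs a * p x.

(* Graphs of real-linear functionals dominated by [p]; being functional
   follows from the domination. *)
Let dominated (g : set (Y * R)) :=
  [/\ g (0, 0),
      forall (l : R) x a y b, g (x, a) -> g (y, b) -> g (l%:C *: x + y, l * a + b)
    & forall x a, g (x, a) -> a <= p x].

Let p0 : p 0 = 0.
Proof. by rewrite -(scale0r 0) pZ cabs0 mul0r. Qed.

Let pZpos (l : R) x : 0 <= l -> p (l%:C *: x) = l * p x.
Proof. by move=> l0; rewrite pZ cabs_real ger0_norm. Qed.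

Let dominated_fun g x a b : dominated g -> g (x, a) -> g (x, b) -> a = b.
Proof.
move=> [_ gL gp] ga gb; apply/eqP; rewrite eq_le.
have h u v : g (x, u) -> g (x, v) -> u <= v.
  move=> gu gv; have := gp _ _ (gL (-1) _ _ _ _ gv gu).
  by rewrite rmorphN1 scaleN1r addNr p0 mulN1r addrC subr_le0.
by rewrite !h.
Qed.

Let extend g y0 : dominated g -> exists g', [/\ dominated g', g `<=` g' &
  exists c, g' (y0, c)].
Proof.
move=> gdom; have [g0 gL gp] := gdom.
have gZ l x a : g (x, a) -> g (l%:C *: x, l * a).
  by move=> gx; have := gL l _ _ _ _ gx g0; rewrite !addr0.
pose F := [set u | exists x a, g (x, a) /\ u = a - p (x - y0)].
have FU x a : g (x, a) -> ubound F (p (x + y0) - a).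
  move=> ga _ [x' [a' [ga' ->]]]; rewrite lerBlDr addrAC lerBrDr.
  have := gp _ _ (gL 1 _ _ _ _ ga' ga); rewrite scale1r mul1r => h.
  apply: le_trans h _; rewrite (_ : x' + x = (x + y0) + (x' - y0)); last first.
    by rewrite addrACA subrr addr0 addrC.
  exact: pD.
have F0 : F (0 - p (0 - y0)) by exists 0, 0.
have Fsup : has_sup F by split; [exists (0 - p (0 - y0))|exists (p (0 + y0) - 0); exact: FU].
(* Any value between the supremum of [a - p (x - y0)] and the infimum of [p (x + y0) - a] would do;
   [FU] shows through [pD] that the interval is nonempty. *)
pose c := sup F.
have cl x a : g (x, a) -> a - p (x - y0) <= c.
  by move=> ga; apply: ub_le_sup => //; [case: Fsup|exists x, a].
have cu x a : g (x, a) -> c <= p (x + y0) - a.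
  by move=> ga; apply: ge_sup; [case: Fsup|exact: FU].
exists [set z | exists x a l, g (x, a) /\ z = (x + l%:C *: y0, a + l * c)].
split; last 2 first.
- by move=> [x a] ga; exists x, a, 0; split; rewrite // scale0r mul0r !addr0.
- by exists c, 0, 0, 1; split; rewrite // scale1r mul1r !add0r.
split.
- by exists 0, 0, 0; split; rewrite // scale0r mul0r !addr0.
- move=> l x a y b [x1 [a1 [l1 [g1 [-> ->]]]]] [x2 [a2 [l2 [g2 [-> ->]]]]].
  exists (l%:C *: x1 + x2), (l * a1 + a2), (l * l1 + l2); split; first exact: gL.
  rewrite !scalerDr rmorphD rmorphM/= scalerDl scalerA; congr (_, _); last by ring.
  by rewrite addrACA.
- move=> y b [x [a [l [ga [-> ->]]]]].
  have [l0|l0|->] := ltgtP l 0; last by rewrite scale0r mul0r !addr0; exact: gp.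
  + have k0 : 0 < - l by rewrite oppr_gt0.
    have k1 : (- l) != 0 by rewrite gt_eqF.
    have /(ler_wpM2l (ltW k0)) := cl _ _ (gZ (- l)^-1 _ _ ga).
    rewrite mulrBr mulrA divff// mul1r -(pZpos _ (ltW k0)) scalerBr scalerA -rmorphM/=.
    by rewrite divff// scale1r rmorphN/= scaleNr opprK; lra.
  + have /(ler_wpM2l (ltW l0)) := cu _ _ (gZ l^-1 _ _ ga).
    have l1 : l != 0 by rewrite gt_eqF.
    rewrite mulrBr mulrA divff// mul1r -(pZpos _ (ltW l0)) scalerDr scalerA -rmorphM/=.
    by rewrite divff// scale1r; lra.
Qed.

(** Zorn on dominated graphs ordered by inclusion: a maximal one is total, since [extend] would
    otherwise enlarge it. *)
Let hahn_banach_graph g0 : dominated g0 ->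
  exists g, [/\ dominated g, g0 `<=` g & forall y, exists c, g (y, c)].
Proof.
move=> g0dom; pose T := {g : set (Y * R) | dominated g /\ g0 `<=` g}.
pose r (s t : T) := `[< sval s `<=` sval t >].
have [||||[g [gdom g0g]] gmax] := @Zorn T r.
- by move=> t; apply/asboolP.
- by move=> s t u /asboolP st /asboolP tu; apply/asboolP; exact: subset_trans tu.
- move=> [s hs] [t ht] /asboolP /= st /asboolP /= ts.
  by apply: eq_exist; rewrite eqEsubset.
- move=> A Atot; have [[t0 At0]|A0] := pselect (exists t, A t); last first.
    exists (exist _ g0 (conj g0dom (@subset_refl _ g0))) => s As.
    by case: A0; exists s.
  pose G := \bigcup_(t in A) sval t.
  suff Gdom : dominated G /\ g0 `<=` G.
    exists (exist _ G Gdom) => s As; apply/asboolP => /= z sz; by exists s.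
  split; last by move=> z g0z; exists t0 => //; case: (svalP t0) => _; apply.
  split.
  + by exists t0 => //; case: (svalP t0) => -[].
  + move=> l x a y b [s As sx] [t At ty].
    have [st|ts] := Atot _ _ As At.
      exists t => //; case: (svalP t) => -[_ h _] _; apply: h => //.
      by move/asboolP: st; apply.
    exists s => //; case: (svalP s) => -[_ h _] _; apply: h => //.
    by move/asboolP: ts; apply.
  + by move=> x a [s As sx]; case: (svalP s) => -[_ _ h] _; exact: h.
exists g; split=> // y.
have [g' [g'dom gg' [c g'y]]] := extend y gdom.
have g0g' : g0 `<=` g' by exact: subset_trans gg'.
have := gmax (exist _ g' (conj g'dom g0g')) _; rewrite /r /=.
have -> : `[< g `<=` g' >] by apply/asboolP.
by move=> /(_ isT) [<-]; exists c.
Qed.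

Lemma hahn_banach_complex (X : lmodType R[i]) (j : {linear X -> Y})
    (phi : {linear X -> R[i]^o}) : (forall x, cabs (phi x) <= p (j x)) ->
  exists psi : {linear Y -> R[i]^o},
    (forall y, cabs (psi y) <= p y) /\ (forall x, psi (j x) = phi x).
Proof.
move=> phip.
pose g0 : set (Y * R) := [set z | exists x, z = (j x, complex.Re (phi x))].
have g0dom : dominated g0.
  split.
  - by exists 0; rewrite !linear0.
  - move=> l x a y b [x1 [-> ->]] [x2 [-> ->]]; exists (l%:C *: x1 + x2).
    by rewrite !linearP ReD ReZ.
  - by move=> x a [x1 [-> ->]]; exact: le_trans (Re_le_cabs _) (phip _).
have [g [gdom g0g /choice[u gu]]] := hahn_banach_graph g0dom.
have [_ gL gp] := gdom.
have uL (l : R) x y : u (l%:C *: x + y) = l * u x + u y.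
  exact: (dominated_fun gdom (gu _)) (gL _ _ _ _ _ (gu x) (gu y)).
have u0 : u 0 = 0 by have := uL (-1) 0 0; rewrite scaler0 addr0; lra.
have uD x y : u (x + y) = u x + u y by have := uL 1 x y; rewrite scale1r mul1r.
have uZ (l : R) x : u (l%:C *: x) = l * u x by have := uL l x 0; rewrite u0 !addr0.
have uj x : u (j x) = complex.Re (phi x).
  by apply: (dominated_fun gdom (gu _)); apply: g0g; exists x.
(* A complex-linear functional is recovered from its real part [u] as u(y) - i u(iy). *)
pose psi (y : Y) : R[i]^o := (u y +i* - u ('i *: y))%C.
have cE (a : R[i]) : a = (complex.Re a)%:C + (complex.Im a)%:C * 'i.
  by rewrite [LHS]complexE mulrC.
have psiL : linear psi.
  move=> a x y; rewrite /psi.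
  have ua z : u (a *: z) = complex.Re a * u z + complex.Im a * u ('i *: z).
    by rewrite {1}[a]cE scalerDl uD uZ -scalerA uZ.
  have ui z : u ('i *: (a *: z)) = complex.Re a * u ('i *: z) - complex.Im a * u z.
    rewrite scalerA mulrC -scalerA ua scalerA -expr2 sqr_i scaleN1r.
    by rewrite -(scaleN1r z) -(rmorphN1 (real_complex R)) uZ; lra.
  apply/eqP; rewrite eq_complex scalerDr !uD ui !ua /= {3 6}[a]complexE /=.
  by case: a {ua ui} => ar ai /=; apply/andP; split; apply/eqP => /=; ring.
pose psiM := GRing.isLinear.Build _ _ _ _ psi psiL.
pose psiT : {linear Y -> R[i]^o} := HB.pack psi psiM.
exists psiT; split=> [y|x]; rewrite /psiT /=; last first.
  rewrite /psi -linearZ/= !uj linearZ/= {3}[phi x]complexE.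
  by case: (phi x) => a b /=; apply/eqP; rewrite eq_complex /=; apply/andP; split; apply/eqP => /=; ring.
(* Rotating [y] by a unimodular scalar makes the value of [psi] real and nonnegative, so the real
   bound on [u] controls the modulus. *)
have [a a1 ay] := cabs_phase (psi y).
have : psi (a *: y) = (cabs (psi y))%:C.
  by rewrite -ay -[psi]/(psiT : Y -> _) linearZ.
move=> [/esym -> _]; apply: le_trans (gp _ _ (gu _)) _.
by rewrite pZ a1 mul1r.
Qed.

End HahnBanach.

(** * The Banach space of bounded functions *)

Section BoundedFunctions.
Context (R : realType) (S : Type).

Definition bounded_pred : {pred S -> R[i]} :=
  [pred f : S -> R[i] | `[< exists M, forall s, cabs (f s) <= M >]].

Lemma bounded_pred_submod : submod_closed bounded_pred.
Proof.
split=> [|a f g /asboolP[M hM] /asboolP[N hN]]; apply/asboolP.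
  by exists 0 => s; rewrite cabs0.
exists (cabs a * M + N) => s; apply: le_trans (cabsD _ _) _.
by rewrite cabsM lerD// ler_wpM2l// cabs_ge0.
Qed.

HB.instance Definition _ :=
  GRing.isSubmodClosed.Build _ _ bounded_pred bounded_pred_submod.

Record bfun := BFun { bval :> S -> R[i]; bvalP : bval \in bounded_pred }.

HB.instance Definition _ := [isSub for bval].
HB.instance Definition _ := [Choice of bfun by <:].
HB.instance Definition _ := [SubChoice_isSubLmodule of bfun by <:].

Implicit Types f g : bfun.

(* The extra value [0] keeps the supremum meaningful when [S] is empty. *)
Let bset f :=
  range (fun o : option S => if o is Some s then cabs (f s) else 0).

Definition bnorm f : R := sup (bset f).

Let bset_sup f : has_sup (bset f).
Proof.
split; first by exists 0, None.
have /asboolP[M hM] := bvalP f.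
by exists (Num.max M 0) => _ [[s|] _ <-]; rewrite le_max ?hM// lexx orbT.
Qed.

Lemma bnorm_ub f s : cabs (f s) <= bnorm f.
Proof. by apply: (sup_upper_bound (bset_sup f)); exists (Some s). Qed.

Lemma bnorm_ge0 f : 0 <= bnorm f.
Proof. by apply: (sup_upper_bound (bset_sup f)); exists None. Qed.

Lemma bnorm_le f M : 0 <= M -> (forall s, cabs (f s) <= M) -> bnorm f <= M.
Proof.
move=> M0 h; apply: ge_sup; first by case: (bset_sup f).
by move=> _ [[s|] _ <-].
Qed.

Lemma bfunD f g s : (f + g) s = f s + g s. Proof. by []. Qed.
Lemma bfunN f s : (- f) s = - f s. Proof. by []. Qed.
Lemma bfunZ (a : R[i]) f s : (a *: f) s = a * f s. Proof. by []. Qed.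

Lemma bfun_ext f g : (forall s, f s = g s) -> f = g.
Proof. by move=> fg; apply/val_inj/funext. Qed.

Let bnormD f g : (bnorm (f + g))%:C <= (bnorm f)%:C + (bnorm g)%:C.
Proof.
rewrite -rmorphD ler_complex; apply: bnorm_le => [|s].
  by rewrite addr_ge0// bnorm_ge0.
by rewrite bfunD (le_trans (cabsD _ _))// lerD// bnorm_ub.
Qed.

Let bnormZ (a : R[i]) f : (bnorm (a *: f))%:C = `|a| * (bnorm f)%:C.
Proof.
have h (b : R[i]) g : bnorm (b *: g) <= cabs b * bnorm g.
  apply: bnorm_le => [|s]; first by rewrite mulr_ge0 ?cabs_ge0 ?bnorm_ge0.
  by rewrite bfunZ cabsM ler_wpM2l ?cabs_ge0 ?bnorm_ub.
rewrite cabsE -rmorphM; congr (_%:C); apply/eqP; rewrite eq_le h/=.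
have [->|a0] := eqVneq a 0; first by rewrite cabs0 mul0r bnorm_ge0.
have := h a^-1 (a *: f); rewrite scalerA mulVf// scale1r cabsV.
by rewrite ler_pdivlMl// lt_def cabs_eq0 a0 cabs_ge0.
Qed.

Let bnorm_eq0 f : (bnorm f)%:C = 0 -> f = 0.
Proof.
move=> [f0]; apply: bfun_ext => s; apply: eq0_normc.
by apply/eqP; rewrite eq_le cabs_ge0 andbT -[leRHS]f0 bnorm_ub.
Qed.

HB.instance Definition _ := Lmodule_isNormed.Build R[i] bfun
  bnormD bnormZ bnorm_eq0.

Lemma bfun_normE f : `|f| = (bnorm f)%:C. Proof. by []. Qed.

Lemma complex_gt0 (e : R[i]) : 0 < e -> exists2 r : R, 0 < r & e = r%:C.
Proof.
case: e => a b; rewrite ltcE /= => /andP[/eqP -> a0]; by exists a.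
Qed.

(** The limit is built pointwise, real and imaginary parts separately, from the completeness of the
    reals; [le] then makes the convergence uniform, at the cost of a factor 3: one for the distance
    to [g] and one for each of the two parts. *)
Lemma bfun_complete (F : set_system bfun) : ProperFilter F -> cauchy F -> cvg F.
Proof.
move=> FF /cauchyP/= Fc.
have Fe (e : R) : 0 < e -> exists f, F [set g | bnorm (f - g) < e].
  move=> e0; have [|f] := Fc e%:C; first by rewrite ltcE /= eqxx.
  rewrite -ball_normE => Ff; exists f; apply: filterS Ff => g.
  by rewrite /ball_/= bfun_normE ltcE /= eqxx.
have lim_ex (u : R[i] -> R) s : (forall x y, u (x - y) = u x - u y) ->
    (forall x, `|u x| <= cabs x) ->
    exists l : R, forall e : R, 0 < e -> F [set g : bfun | `|l - u (g s)| < e].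
  move=> uB un.
  have /cvg_ex[l hl] : cvg ((fun g : bfun => u (g s)) @ F).
    apply: R_complete; apply/cauchyP => e e0; have [f Ff] := Fe _ e0.
    exists (u (f s)); rewrite -ball_normE.
    change (F [set g : bfun | `|u (f s) - u (g s)| < e]).
    apply: filterS Ff => g fg; apply: le_lt_trans fg; rewrite -uB.
    exact: le_trans (un _) (bnorm_ub (f - g) s).
  by exists l => e e0; move/cvgrPdist_lt: hl; apply.
have /choice[lr hlr] : forall s, exists l : R, forall e : R, 0 < e ->
    F [set g : bfun | `|l - complex.Re (g s)| < e].
  by move=> s; apply: lim_ex => [[? ?] [? ?]//|x]; exact: normr_Re_le.
have /choice[li hli] : forall s, exists l : R, forall e : R, 0 < e ->
    F [set g : bfun | `|l - complex.Im (g s)| < e].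
  by move=> s; apply: lim_ex => [[? ?] [? ?]//|x]; exact: normr_Im_le.
pose l s : R[i] := (lr s +i* li s)%C.
have le f (e : R) s : 0 < e -> F [set g | bnorm (f - g) < e] -> cabs (f s - l s) <= 3 * e.
  move=> e0 Ff.
  have [g [[fg gr] gi]] := filter_ex (filterI (filterI Ff (hlr s _ e0)) (hli s _ e0)).
  have {}fg : bnorm (f - g) < e by [].
  have {}gr : `|lr s - complex.Re (g s)| < e by [].
  have {}gi : `|li s - complex.Im (g s)| < e by [].
  apply: le_trans (cabs_tri (g s) _ _) _.
  have := bnorm_ub (f - g) s; rewrite bfunD bfunN => h1.
  have : cabs (g s - l s) <= e + e.
    move: gr gi; rewrite /l ![`|_ s - _|]distrC.
    by case: (g s) => u v /ltW gr /ltW gi; apply: cabs_le_ReIm; [exact: gr|exact: gi].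
  lra.
have lb : l \in bounded_pred.
  have [f Ff] := Fe 1 ltr01; apply/asboolP; exists (bnorm f + 3) => s.
  have := le f 1 s ltr01 Ff; have := bnorm_ub f s.
  have := lerB_cabs (f s) (l s); rewrite ler_norml => /andP[+ _]; lra.
apply/cvg_ex; exists (BFun lb); apply/cvgrPdist_lt => _ /complex_gt0[e e0 ->].
have e4 : 0 < e / 5 by lra.
have [f Ff] := Fe _ e4; near=> g.
have fg : bnorm (f - g) < e / 5 by near: g.
rewrite bfun_normE ltcE /= eqxx/=.
apply: le_lt_trans (_ : 4 * (e / 5) < e); last by lra.
apply: bnorm_le => [|s]; first by lra.
rewrite bfunD bfunN -[BFun lb s]/(l s).
apply: le_trans (cabs_tri (f s) _ _) _; have := le f _ s e4 Ff; rewrite cabsB => h.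
by have := bnorm_ub (f - g) s; rewrite bfunD bfunN; lra.
Unshelve. all: by end_near. Qed.

HB.instance Definition _ := Uniform_isComplete.Build bfun bfun_complete.

Definition bfun_banach : completeNormedModType R[i] := bfun.

End BoundedFunctions.

(** * Roots of unity *)

Section Mean.
Context (F : numFieldType) (T : finType).
Implicit Types f g : T -> F.

Definition mean f : F := (\sum_t f t) / #|T|%:R.

Lemma meanD f g : mean (fun t => f t + g t) = mean f + mean g.
Proof. by rewrite /mean big_split mulrDl. Qed.

Lemma meanZ a f : mean (fun t => a * f t) = a * mean f.
Proof. by rewrite /mean -mulr_sumr mulrA. Qed.

Lemma meanN f : mean (fun t => - f t) = - mean f.
Proof. by rewrite /mean sumrN mulNr. Qed.

Lemma meanB f g : mean (fun t => f t - g t) = mean f - mean g.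
Proof. by rewrite meanD meanN. Qed.

Lemma mean_sum (I : Type) (r : seq I) (P : pred I) (f : I -> T -> F) :
  mean (fun t => \sum_(i <- r | P i) f i t) = \sum_(i <- r | P i) mean (f i).
Proof. by rewrite /mean exchange_big mulr_suml. Qed.

Lemma eq_mean f g : f =1 g -> mean f = mean g.
Proof. by move=> fg; rewrite /mean (eq_bigr g). Qed.

Lemma reindex_mean (s : T -> T) f : injective s -> mean (f \o s) = mean f.
Proof.
by move=> s_inj; rewrite /mean [in RHS](reindex s)//; exact/onW_bij/injF_bij.
Qed.

Lemma ler_mean f g : (forall t, f t <= g t) -> mean f <= mean g.
Proof.
by move=> fg; rewrite ler_wpM2r ?invr_ge0 ?ler0n//; apply: ler_sum.
Qed.

Lemma mean_ge0 f : (forall t, 0 <= f t) -> 0 <= mean f.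
Proof. by move=> f0; rewrite divr_ge0 ?ler0n// sumr_ge0. Qed.

Lemma mean_const a : (0 < #|T|)%N -> mean (fun=> a) = a.
Proof.
by move=> T0; rewrite /mean sumr_const -[a *+ _]mulr_natr mulfK// pnatr_eq0 -lt0n.
Qed.

(** Reindexing by [s] gives mean f = c mean f. All orthogonality relations and all vanishing moments
    below come from this, with [s] the rotation of one coordinate by a root of unity. *)
Lemma mean_eigen0 (s : T -> T) (c : F) f : injective s -> c != 1 ->
  (forall t, f (s t) = c * f t) -> mean f = 0.
Proof.
move=> s_inj c1 fs; apply/eqP; have := reindex_mean f s_inj.
rewrite (eq_mean (g := fun t => c * f t))// meanZ => /eqP.
by rewrite -[X in _ == X]mul1r -subr_eq0 -mulrBl mulf_eq0 subr_eq0 (negbTE c1).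
Qed.

End Mean.

Section RealComplexMean.
Context (R : realType) (T : finType).

Lemma mean_cabs (f : T -> R[i]) : cabs (mean f) <= mean (fun t => cabs (f t)).
Proof.
rewrite /mean cabsM cabsV cabs_nat ler_wpM2r ?invr_ge0 ?ler0n//.
exact: cabs_sum.
Qed.

Lemma mean_complex (f : T -> R) : (mean f)%:C = mean (fun t => (f t)%:C).
Proof. by rewrite /mean rmorphM rmorph_sum fmorphV rmorph_nat. Qed.

Lemma Re_mean (f : T -> R[i]) : complex.Re (mean f) = mean (fun t => complex.Re (f t)).
Proof.
rewrite /mean mulrC -(rmorph_nat (real_complex R)) -fmorphV ReZ mulrC.
by congr (_ * _); apply: (big_morph _ (@ReD R)).
Qed.

Lemma mean_CauchySchwarz (f g : T -> R) :
  mean (fun t => f t * g t) ^+ 2 <= mean (fun t => f t ^+ 2) * mean (fun t => g t ^+ 2).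
Proof.
set a := mean (fun t => f t ^+ 2); set b := mean _; set c := mean (fun t => g t ^+ 2).
have q x y : 0 <= x ^+ 2 * a + 2 * x * y * b + y ^+ 2 * c.
  rewrite -!meanZ -!meanD; apply: mean_ge0 => t.
  rewrite (_ : _ + _ = (x * f t + y * g t) ^+ 2); first exact: sqr_ge0.
  by ring.
have [a0|a0|a0] := ltgtP a 0.
- by have := q 1 0; lra.
- have := q b (- a); have -> : b ^+ 2 * a + 2 * b * (- a) * b + (- a) ^+ 2 * c =
    a * (a * c - b ^+ 2) by ring.
  by rewrite pmulr_rge0// subr_ge0.
- have [->|b0] := eqVneq b 0; first by rewrite a0 expr0n/= mul0r.
  (* With [a = 0] the form is affine in [x]; this choice makes it equal to -1. *)
  have := q (- (c + 1) / (2 * b)) 1; rewrite a0.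
  have -> : (- (c + 1) / (2 * b)) ^+ 2 * 0 + 2 * (- (c + 1) / (2 * b)) * 1 * b + 1 ^+ 2 * c = -1.
    by field.
  by lra.
Qed.

End RealComplexMean.

Section Torus.
Context (R : realType) (n N : nat) (w : R[i]).
Hypothesis w_prim : N.+1.-primitive_root w.
Local Notation G := {ffun 'I_n -> 'I_N.+1}.
Implicit Types (z : 'I_n -> R[i]) (g : G) (k : 'I_n) (a b : 'I_n -> nat).

(** For fixed [z], these are the points of the coset of [z] under tuples of roots of unity of order
    [N.+1]. *)
Definition zeta z g k : R[i] := z k * w ^+ g k.

Definition unimodular (I : Type) (z : I -> R[i]) := forall i, cabs (z i) = 1.

Lemma cabs_root : cabs w = 1.
Proof.
have /eqP := congr1 (@cabs R) (prim_expr_order w_prim).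
by rewrite cabsX cabs1 pexpr_eq1 ?cabs_ge0// => /eqP.
Qed.

Lemma conj_unimodular (x : R[i]) : cabs x = 1 -> x * x^* = 1.
Proof. by move=> x1; rewrite mulr_conj x1 expr1n. Qed.

Lemma zeta_unimodular z g : unimodular z -> unimodular (zeta z g).
Proof. by move=> z1 k; rewrite /zeta cabsM cabsX cabs_root expr1n mulr1. Qed.

Lemma card_torus_gt0 : (0 < #|{: G}|)%N.
Proof. by apply/card_gt0P; exists [ffun=> ord0]. Qed.

Definition shift k g : G := [ffun i => if i == k then ordS (g i) else g i].

Lemma shift_inj k : injective (shift k).
Proof.
move=> g h /ffunP gh; apply/ffunP => i; have := gh i; rewrite !ffunE.
by case: ifP => // _; exact: ordS_inj.
Qed.

Lemma zeta_shift z g k i :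
  zeta z (shift k g) i = (if i == k then w else 1) * zeta z g i.
Proof.
rewrite /zeta ffunE; case: ifP => _; last by rewrite mul1r.
by rewrite mulrCA -exprS -[in RHS](prim_expr_mod w_prim).
Qed.

Definition mono a (z : 'I_n -> R[i]) : R[i] := \prod_k z k ^+ a k.

Lemma mono_shift a z g k :
  mono a (zeta z (shift k g)) = w ^+ a k * mono a (zeta z g).
Proof.
rewrite /mono (bigD1 k)//= [in RHS](bigD1 k)//= mulrA zeta_shift eqxx exprMn.
by congr (_ * _); apply: eq_bigr => i /negbTE ik; rewrite zeta_shift ik mul1r.
Qed.

Lemma cabs_mono a z : unimodular z -> cabs (mono a z) = 1.
Proof.
by move=> z1; rewrite cabs_prod big1// => i _; rewrite cabsX z1 expr1n.
Qed.

(** Shifting coordinate [k] multiplies the product by [w] to the power a k - b k; exponents at most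
    [N] are distinct modulo [N.+1], so this factor is not 1. *)
Lemma mean_mono_eq0 a b z k : (a k <= N)%N -> (b k <= N)%N -> a k != b k ->
  mean (fun g => mono a (zeta z g) * (mono b (zeta z g))^*) = 0.
Proof.
move=> aN bN ab; apply: (@mean_eigen0 _ _ (shift k) (w ^+ a k * (w ^+ b k)^*)).
- exact: shift_inj.
- apply: contra ab => /eqP/(congr1 ( *%R^~ (w ^+ b k))).
  rewrite mul1r mulrAC -mulrA conj_unimodular ?cabsX ?cabs_root ?expr1n// mulr1.
  by move/eqP; rewrite (eq_prim_root_expr w_prim) !modn_small.
- by move=> g; rewrite !mono_shift rmorphM mulrACA.
Qed.

Lemma mean_mono_norm a z : unimodular z ->
  mean (fun g => mono a (zeta z g) * (mono a (zeta z g))^*) = 1.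
Proof.
move=> z1; rewrite (eq_mean (g := fun=> 1)) ?mean_const ?card_torus_gt0// => g.
by rewrite conj_unimodular// cabs_mono//; exact: zeta_unimodular.
Qed.

Lemma prod_mono (A : {set 'I_n}) (z : 'I_n -> R[i]) :
  \prod_(j in A) z j = mono (fun k => (k \in A)) z.
Proof. by rewrite big_mkcond; apply: eq_bigr => k _; case: (k \in A). Qed.

Lemma mean_set_orthonormal (A B : {set 'I_n}) z : (0 < N)%N -> unimodular z ->
  mean (fun g => \prod_(j in A) zeta z g j * (\prod_(j in B) zeta z g j)^*)
    = (A == B)%:R.
Proof.
move=> N0 z1; rewrite (eq_mean (g := fun g => mono (fun k => (k \in A)) (zeta z g) *
  (mono (fun k => (k \in B)) (zeta z g))^*)); last by move=> g; rewrite !prod_mono.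
have [->|AB] := eqVneq A B; first exact: mean_mono_norm.
have [k kAB] : exists k, (k \in A) != (k \in B).
  apply/existsP; rewrite -negb_forall; apply: contra AB => /forallP h.
  by apply/eqP/setP => k; exact/eqP.
apply: (@mean_mono_eq0 (fun i => (i \in A)) (fun i => (i \in B)) z k).
- exact: leq_trans (leq_b1 _) N0.
- exact: leq_trans (leq_b1 _) N0.
- by case: (k \in A) (k \in B) kAB => [] [].
Qed.

End Torus.

(** * Roots of unity of large order are dense in the unit circle *)

Section Roots.
Context (R : realType).
Implicit Types (t : R).

Definition cis t : R[i] := (cos t +i* sin t)%C.

Lemma cisD s t : cis (s + t) = cis s * cis t.
Proof. by rewrite /cis cosD sinD; simpc; congr (_ +i* _)%C; ring. Qed.

Lemma cis0 : cis 0 = 1. Proof. by rewrite /cis cos0 sin0. Qed.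

Lemma cisMn t m : cis (t *+ m) = cis t ^+ m.
Proof.
elim: m => [|m IH]; first by rewrite mulr0n cis0.
by rewrite mulrS cisD IH exprS.
Qed.

Lemma cis2pi : cis (pi *+ 2) = 1.
Proof. by rewrite /cis cos2pi sin2pi. Qed.

Lemma cabs_cis t : cabs (cis t) = 1.
Proof. by rewrite /cabs /= cos2Dsin2 sqrtr1. Qed.

Lemma cis_ex (u : R[i]) : cabs u = 1 -> exists t, u = cis t.
Proof.
case: u => a b u1; have ab : a ^+ 2 + b ^+ 2 = 1.
  by have := cabs_sqr (a +i* b)%C; rewrite u1 expr1n.
have aI : -1 <= a <= 1.
  by rewrite -ler_norml -(expr_le1 (n:=2))// real_normK ?num_real//; have := sqr_ge0 b; lra.
have sE : Num.sqrt (1 - a ^+ 2) = `|b|.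
  by rewrite -ab addrAC subrr add0r sqrtr_sqr.
have [b0|b0] := leP 0 b.
  by exists (acos a); rewrite /cis acosK// sin_acos// sE ger0_norm.
exists (- acos a); rewrite /cis cosN sinN acosK// sin_acos// sE ltr0_norm//.
by rewrite opprK.
Qed.

Lemma cis_near1 (e : R) : 0 < e -> exists2 d : R, 0 < d &
  forall t, `|t| < d -> cabs (cis t - 1) <= e.
Proof.
move=> e0; have e2 : 0 < e / 2 by lra.
have [d1 /= d10 h1] : \forall t \near (0 : R), `|cos 0 - cos t| < e / 2.
  by have /cvgrPdist_lt := @continuous_cos R 0; apply.
have [d2 /= d20 h2] : \forall t \near (0 : R), `|sin 0 - sin t| < e / 2.
  by have /cvgrPdist_lt := @continuous_sin R 0; apply.
exists (Num.min d1 d2); first by rewrite lt_min d10.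
move=> t; rewrite lt_min => /andP[td1 td2].
have := h1 t; rewrite /ball_/= sub0r normrN cos0 distrC => /(_ td1)/ltW c.
have := h2 t; rewrite /ball_/= sub0r normrN sin0 distrC => /(_ td2)/ltW s.
by rewrite [e]splitr; apply: (@cabs_le_ReIm _ (cis t - 1) (e / 2) (e / 2)).
Qed.

(** A smaller positive power has real part cos(2 a) with 0 < a < pi; there sin a > 0, so the real
    part is not 1. *)
Lemma cis_prim (N : nat) : N.+1.-primitive_root (cis (pi *+ 2 / N.+1%:R)).
Proof.
apply/andP; split=> //; apply/forallP => i; apply/eqP.
set x := pi *+ 2 / _; have xN : x *+ N.+1 = pi *+ 2.
  by rewrite -mulr_natr mulfVK// pnatr_eq0.
rewrite unity_rootE -cisMn; have [->|iN] := eqVneq i.+1 N.+1.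
  by rewrite xN cis2pi eqxx.
have {}iN : (i.+1 < N.+1)%N by rewrite ltn_neqAle iN/=.
apply/negbTE/eqP => /(congr1 (@complex.Re R))/=.
have -> : x *+ i.+1 = (pi * (i.+1%:R / N.+1%:R)) *+ 2.
  by rewrite /x -[LHS]mulr_natr -[RHS]mulr_natr -[pi *+ 2]mulr_natr mulrAC [RHS]mulrAC mulrA mulrAC.
rewrite cos_mulr2n => h.
have : 0 < sin (pi * (i.+1%:R / N.+1%:R) : R).
  apply: sin_gt0_pi; rewrite mulr_gt0 ?pi_gt0 ?divr_gt0 ?ltr0n//=.
  by rewrite gtr_pMr ?pi_gt0// ltr_pdivrMr ?ltr0n// mul1r ltr_nat.
have := cos2Dsin2 (pi * (i.+1%:R / N.+1%:R) : R); nra.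
Qed.

Lemma roots_dense (e : R) : 0 < e -> exists N (w : R[i]),
  [/\ (1 < N)%N, N.+1.-primitive_root w & forall z, cabs z = 1 ->
    exists (m : 'I_N.+1) (s : R[i]),
      [/\ z = w ^+ m * s, cabs s = 1 & cabs (s - 1) <= e]].
Proof.
move=> /cis_near1[d d0 hd].
(* This makes the mesh 2 pi / (N + 1) smaller than [d], and the double successor ensures that the
   order is at least 3. *)
pose N := (Num.truncn (pi *+ 2 / d)).+2; exists N.
pose x : R := pi *+ 2 / N.+1%:R; exists (cis x); split=> //; first exact: cis_prim.
have x0 : 0 < x by rewrite divr_gt0 ?ltr0n// mulrn_wgt0 ?pi_gt0.
have xd : x < d.
  rewrite ltr_pdivrMr ?ltr0n// mulrC -ltr_pdivrMr//.
  by apply: lt_trans (truncnS_gt _) _; rewrite ltr_nat.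
move=> z /cis_ex[t ->].
(* Full turns are added so that the angle is nonnegative before it is divided with remainder by the
   mesh. *)
pose k := (Num.truncn (`|t| / (pi *+ 2))).+1.
pose t' := t + (pi *+ 2) *+ k.
have cist' : cis t' = cis t by rewrite /t' cisD cisMn cis2pi expr1n mulr1.
have pi2 : 0 < pi *+ 2 :> R by rewrite mulrn_wgt0 ?pi_gt0.
have t'0 : 0 <= t'.
  have := truncnS_gt (`|t| / (pi *+ 2)); rewrite ltr_pdivrMr// mulr_natl.
  by rewrite /t' -/k; have := ler_norm (- t); rewrite normrN; lra.
pose q := Num.truncn (t' / x).
have /andP[q1 q2] := truncn_itv (divr_ge0 t'0 (ltW x0)).
have qN : (q %% N.+1 < N.+1)%N by rewrite ltn_pmod.
exists (Ordinal qN), (cis (t' - x *+ q)); split.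
- by rewrite /= (prim_expr_mod (cis_prim N)) -cisMn -cisD addrC subrK cist'.
- exact: cabs_cis.
- apply: hd; move: q1 q2; rewrite -/q ler_pdivlMr// ltr_pdivrMr// -natr1 mulrDl mul1r mulr_natl.
  by move=> q1 q2; rewrite ger0_norm; lra.
Qed.

End Roots.

(** * Upper bound for the projection constant *)

Section TetraEval.
Context (R : realType) (n d : nat).
Local Notation dset := {A : {set 'I_n} | #|A| == d}.
Implicit Types (P : tetra R n d) (z : 'I_n -> R[i]) (A B : dset).

Definition monA A z : R[i] := \prod_(j in val A) z j.

Definition evalf P z : R[i] := \sum_A tetra_coef P A * monA A z.

Definition esym z : R[i] := \sum_A monA A z.

Lemma evalfE P (z : 'rV[R[i]]_n) : tetra_eval P z = evalf P (z ord0).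
Proof. by []. Qed.

Lemma evalfP (a : R[i]) P Q z : evalf (a *: P + Q) z = a * evalf P z + evalf Q z.
Proof.
pose x : 'rV[R[i]]_n := \row_j z j.
have xE (T : tetra R n d) : evalf T z = tetra_eval T x.
  by apply: eq_bigr => A _; congr (_ * _); apply: eq_bigr => j _; rewrite mxE.
by rewrite !xE tetra_evalD tetra_evalZ.
Qed.

Definition upd z k u : 'I_n -> R[i] := fun i => if i == k then u else z i.

Lemma monA_affine A z k u :
  monA A (upd z k u) = monA A (upd z k 0) + (monA A (upd z k 1) - monA A (upd z k 0)) * u.
Proof.
rewrite /monA; have [kA|kA] := boolP (k \in val A); last first.
  have h v : \prod_(j in val A) upd z k v j = \prod_(j in val A) z j.
    by apply: eq_bigr => j jA; rewrite /upd; case: eqP kA => // <-; rewrite jA.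
  by rewrite !h subrr mul0r addr0.
have h v : \prod_(j in val A) upd z k v j =
    v * \prod_(j in val A | j != k) z j.
  rewrite (bigD1 k)//= /upd eqxx; congr (_ * _).
  by apply: eq_bigr => j /andP[_ /negbTE ->].
by rewrite !h; ring.
Qed.

Lemma evalf_affine P z k : exists a b, forall u, evalf P (upd z k u) = a + b * u.
Proof.
exists (evalf P (upd z k 0)), (evalf P (upd z k 1) - evalf P (upd z k 0)) => u.
rewrite /evalf -sumrB mulr_suml -big_split/=; apply: eq_bigr => A _.
by rewrite monA_affine; ring.
Qed.

(** The point [u] aligns the phases of [a] and [b * u], so the right-hand modulus is |a| + |b|. *)
Lemma affine_max (a b v : R[i]) : cabs v <= 1 ->
  exists2 u, cabs u = 1 & cabs (a + b * v) <= cabs (a + b * u).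
Proof.
move=> v1; have [x x1 xa] := cabs_phase a; have [y y1 yb] := cabs_phase b.
have x0 : x != 0 by rewrite -cabs_eq0 x1 oner_eq0.
exists (y / x); first by rewrite cabsM cabsV x1 y1 divr1.
have -> : a + b * (y / x) = (x * a + y * b) / x by field.
rewrite cabsM cabsV x1 invr1 mulr1 xa yb -rmorphD cabs_real ger0_norm; last first.
  by rewrite addr_ge0 ?cabs_ge0.
by rewrite (le_trans (cabsD _ _))// lerD2l cabsM ler_piMr ?cabs_ge0.
Qed.

(** A maximum principle without complex analysis: a tetrahedral polynomial is affine in each
    variable, so the coordinates can be pushed to the unit circle one at a time without decreasing
    the modulus. *)
Lemma evalf_torus P z : (forall k, cabs (z k) <= 1) ->
  exists2 z', unimodular z' & cabs (evalf P z) <= cabs (evalf P z').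
Proof.
move=> z1.
suff [z' [h1 _ h2]] : exists z', [/\ forall k, k \in enum 'I_n -> cabs (z' k) = 1,
    forall k, cabs (z' k) <= 1 & cabs (evalf P z) <= cabs (evalf P z')].
  by exists z' => // k; apply: h1; rewrite mem_enum.
elim: (enum _) => [|k s [z' [IH1 IH2 IH3]]]; first by exists z.
have [a [b ab]] := evalf_affine P z' k.
have [u u1 hu] := affine_max a b (IH2 k).
exists (upd z' k u); split.
- move=> i; rewrite /upd inE; case: eqP => //= _; exact: IH1.
- by move=> i; rewrite /upd; case: eqP => // _; rewrite u1.
- apply: le_trans IH3 _; rewrite ab; apply: le_trans hu.
  rewrite -ab le_eqVlt; apply/orP; left; apply/eqP; congr cabs; congr evalf.
  by apply/funext => i; rewrite /upd; case: eqP => // ->.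
Qed.

Lemma tetra_norm_torus P (M : R) :
  (forall z, unimodular z -> cabs (evalf P z) <= M) -> tetra_norm P <= M.
Proof.
move=> h; apply: tetra_norm_lub => z /rV_norm_le1 z1; rewrite evalfE.
have [|z' z'1 zz'] := evalf_torus P (z := z ord0).
  by move=> k; have := z1 k; rewrite -ler_complex -cabsE.
exact: le_trans zz' (h _ z'1).
Qed.

Lemma evalf_le_norm P z : unimodular z -> cabs (evalf P z) <= tetra_norm P.
Proof.
move=> z1; pose x : 'rV[R[i]]_n := \row_j z j.
have -> : evalf P z = tetra_eval P x.
  by apply: eq_bigr => A _; congr (_ * _); apply: eq_bigr => j _; rewrite mxE.
by apply: tetra_norm_ub; apply/rV_norm_le1 => j; rewrite mxE cabsE z1.
Qed.

Lemma monAM A z y : monA A (fun k => z k * y k) = monA A z * monA A y.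
Proof. exact: big_split. Qed.

Lemma monAJ A z : monA A (fun k => (z k)^*) = (monA A z)^*.
Proof. by rewrite /monA rmorph_prod. Qed.

Lemma cabs_monA A z : unimodular z -> cabs (monA A z) = 1.
Proof. by move=> z1; rewrite cabs_prod big1. Qed.

Lemma mean_monA N (w : R[i]) A B z : (0 < N)%N -> N.+1.-primitive_root w ->
  unimodular z ->
  mean (fun g : {ffun 'I_n -> 'I_N.+1} => monA A (zeta w z g) * (monA B (zeta w z g))^*)
    = (A == B)%:R.
Proof.
by move=> N0 wp z1; rewrite (mean_set_orthonormal wp)// -(inj_eq val_inj).
Qed.

Definition tetra_of (c : dset -> R[i]) : tetra R n d := [ffun A => c A].

Lemma tetra_ofE c A : tetra_coef (tetra_of c) A = c A.
Proof. exact: ffunE. Qed.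

End TetraEval.

(** * Operator norms and continuity of linear maps *)

Section OpNorm.
Context (R : realType).

Lemma linear_bounded_cont (V W : normedModType R[i]) (f : {linear V -> W}) (M : R) :
  (forall v, `|f v| <= M%:C * `|v|) -> continuous f.
Proof.
move=> h v; apply/cvgrPdist_le => _ /complex_gt0[e e0 ->].
near=> u; rewrite -linearB; apply: le_trans (h _) _.
have M1 : 0 < `|M| + 1 by rewrite ltr_wpDl.
apply: (@le_trans _ _ ((`|M| + 1)%:C * `|v - u|)).
  by rewrite ler_wpM2r// ler_complex (le_trans (ler_norm _))// lerDl.
have : `|v - u| <= (e / (`|M| + 1))%:C.
  near: u; apply: cvgr_dist_le => //.
  by rewrite ltcE /= eqxx divr_gt0.
move=> /(ler_wpM2l (x := (`|M| + 1)%:C)) /=.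
by rewrite -rmorphM/= mulrCA divff ?gt_eqF// mulr1; apply; rewrite (ler_complex 0) ltW.
Unshelve. all: by end_near. Qed.

Lemma op_norm_le (V W : normedModType R[i]) (f : V -> W) (M : R) :
  (forall v, `|v| <= 1 -> `|f v| <= M%:C) -> (op_norm f <= M%:E)%E.
Proof.
move=> h; apply: ge_ereal_sup => _ [v v1 <-].
by have := h v v1; rewrite lecE => /andP[_ fM]; rewrite lee_fin.
Qed.

Lemma le_op_norm (V W : normedModType R[i]) (f : {linear V -> W}) (M : R) :
  (op_norm f <= M%:E)%E -> forall v, `|v| <= 1 -> `|f v| <= M%:C.
Proof.
move=> h v v1; have : ((complex.Re `|f v|)%:E <= op_norm f)%E.
  by apply: ereal_sup_ubound; exists v.
move=> /le_trans/(_ h); rewrite lee_fin => fM.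
have := normr_ge0 (f v); rewrite !lecE /= => /andP[/eqP -> _].
by rewrite eqxx.
Qed.

End OpNorm.

Section UpperBound.
Context (R : realType) (n d N : nat) (w : R[i]) (M : R).
Hypotheses (N0 : (0 < N)%N) (w_prim : N.+1.-primitive_root w).
Hypothesis M_bound : forall z : 'I_n -> R[i], unimodular z ->
  mean (fun g : {ffun 'I_n -> 'I_N.+1} => cabs (esym d (zeta w z g))) <= M.
Local Notation G := {ffun 'I_n -> 'I_N.+1}.
Local Notation X := (tetra R n d).

Let one : 'I_n -> R[i] := fun=> 1.
(** The conjugate lets a plain product of a monomial at the tuple with an evaluation at [pt g]
    average to a Fourier coefficient. *)
Let pt (g : G) : 'I_n -> R[i] := fun k => (zeta w one g k)^*.

Let one_unimodular : unimodular one. Proof. by move=> k; exact: cabs1. Qed.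

Let pt_unimodular g : unimodular (pt g).
Proof. by move=> k; rewrite /pt cabsJ (zeta_unimodular w_prim). Qed.

Lemma rel_proj_const_le (Y : completeNormedModType R[i]) (j : {linear X -> Y}) :
  (forall x, `|j x| = `|x|) -> (rel_proj_const (range j) <= M%:E)%E.
Proof.
move=> j_iso.
pose p (y : Y) : R := complex.Re `|y|.
have pE y : `|y| = (p y)%:C.
  by have := normr_ge0 y; rewrite lecE /p; case: `|y| => a b /= /andP[/eqP ->].
have pD x y : p (x + y) <= p x + p y.
  by rewrite -ler_complex rmorphD/= -!pE ler_normD.
have pZ a x : p (a *: x) = cabs a * p x.
  by have := normrZ a x; rewrite !pE cabsE -rmorphM => -[].
have phi_ex g : exists psi : {linear Y -> R[i]^o},
    (forall y, cabs (psi y) <= p y) /\ (forall P, psi (j P) = evalf P (pt g)).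
  pose phi (P : X) : R[i]^o := evalf P (pt g).
  have phiL : linear phi by move=> a P Q; rewrite /phi evalfP.
  pose phiT : {linear X -> R[i]^o} :=
    HB.pack phi (GRing.isLinear.Build _ _ _ _ phi phiL).
  apply: (hahn_banach_complex (p := p) pD pZ (phi := phiT)) => P.
  rewrite /phiT/= /phi (le_trans (evalf_le_norm _ _))//.
  by have := j_iso P; rewrite pE => -[->].
have [psi hpsi] := choice phi_ex.
(* The Fourier coefficient formula, with evaluations replaced by their extensions, makes sense on
   all of [Y]; on the copy of the polynomials it returns the true coefficient. *)
pose coef (A : {A : {set 'I_n} | #|A| == d}) y : R[i] :=
  mean (fun g => monA A (zeta w one g) * psi g y).
have coef_lin A a x y : coef A (a *: x + y) = a * coef A x + coef A y.
  rewrite /coef -meanZ -meanD; apply: eq_mean => g; rewrite linearP/=.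
  by rewrite [in LHS]/GRing.scale/=; ring.
have coef_j A P : coef A (j P) = tetra_coef P A.
  rewrite /coef (eq_mean (g := fun g => \sum_B (tetra_coef P B *
      (monA A (zeta w one g) * (monA B (zeta w one g))^*)))); last first.
    move=> g; rewrite (hpsi g).2 /evalf mulr_sumr; apply: eq_bigr => B _.
    by rewrite mulrCA monAJ.
  rewrite mean_sum (bigD1 A)//= meanZ (mean_monA _ _ N0 w_prim)// eqxx mulr1.
  rewrite big1 ?addr0// => B BA; rewrite meanZ (mean_monA _ _ N0 w_prim)//.
  by rewrite eq_sym (negbTE BA) mulr0.
pose T y : X := tetra_of (coef^~ y).
have T_lin a x y : T (a *: x + y) = a *: T x + T y.
  by apply/ffunP => A; rewrite !ffunE coef_lin.
have Tj P : T (j P) = P by apply/ffunP => A; rewrite ffunE coef_j.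
have T_norm y : tetra_norm (T y) <= M * p y.
  apply: tetra_norm_torus => z z1.
  (* Monomials are multiplicative, so summing over [A] collects them into the kernel e_d on the
     coset of [z]; its mean modulus there is at most [M]. *)
  have -> : evalf (T y) z = mean (fun g => psi g y * esym d (zeta w z g)).
    transitivity (mean (fun g => \sum_(A : {A : {set 'I_n} | #|A| == d})
      psi g y * monA A (zeta w z g))); last first.
      by apply: eq_mean => g; rewrite mulr_sumr.
    rewrite mean_sum; apply: eq_bigr => A _; rewrite tetra_ofE mulrC -meanZ.
    apply: eq_mean => g; rewrite mulrA [RHS]mulrC; congr (_ * _).
    by rewrite -monAM; apply: eq_bigr => k _; rewrite /zeta /one mul1r.
  apply: le_trans (mean_cabs _) _; rewrite mulrC.
  apply: (@le_trans _ _ (p y * mean (fun g : G => cabs (esym d (zeta w z g))))).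
    rewrite -meanZ; apply: ler_mean => g; rewrite cabsM.
    by rewrite ler_wpM2r ?cabs_ge0 ?(hpsi g).1.
  by rewrite ler_wpM2l ?M_bound//; have := normr_ge0 y; rewrite pE lecE => /andP[].
pose Q y : Y := j (T y).
have QL : linear Q by move=> a x y; rewrite /Q T_lin linearP.
pose QT : {linear Y -> Y} := HB.pack Q (GRing.isLinear.Build _ _ _ _ Q QL).
have Q_norm y : `|QT y| <= M%:C * `|y|.
  by rewrite /QT/= /Q j_iso pE -rmorphM ler_complex T_norm.
apply: (@le_trans _ _ (op_norm (QT : Y -> Y))).
  apply: ereal_inf_lbound; exists QT => //; split.
  - exact: linear_bounded_cont Q_norm.
  - by move=> y; rewrite /QT/= /Q Tj.
  - apply/seteqP; split=> [_ [y _ <-]|_ [P _ <-]]; first by exists (T y).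
    by exists (j P) => //; rewrite /QT/= /Q Tj.
apply: op_norm_le => y y1; apply: le_trans (Q_norm y) _.
have M0 : 0 <= M.
  apply: le_trans (M_bound one_unimodular); apply: mean_ge0 => g; exact: cabs_ge0.
by rewrite ler_piMr// (ler_complex 0).
Qed.

Lemma proj_const_le : (proj_const X <= M%:E)%E.
Proof.
by apply: ge_ereal_sup => _ [Y [j [j_iso ->]]]; exact: rel_proj_const_le.
Qed.

End UpperBound.

(** * Lower bound for the projection constant *)

Section SmoothSign.
Context (R : realType) (k : R).
Hypothesis k0 : 0 < k.

Definition smooth_sign (x : R[i]) : R[i] := x / (cabs x + k)%:C.

Let cabsk (x : R[i]) : cabs (cabs x + k)%:C = cabs x + k.
Proof. by rewrite cabs_real ger0_norm// addr_ge0 ?cabs_ge0 ?ltW. Qed.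

Let den_gt0 (x : R[i]) : 0 < cabs x + k.
Proof. by rewrite ltr_wpDl ?cabs_ge0. Qed.

Lemma smooth_sign_le1 x : cabs (smooth_sign x) <= 1.
Proof.
by rewrite /smooth_sign cabsM cabsV cabsk ler_pdivrMr// mul1r lerDl ltW.
Qed.

(** The constant degenerates as [k] tends to 0, which is harmless because the order of the roots is
    chosen after [k]. *)
Lemma smooth_sign_lipschitz x y :
  cabs (smooth_sign x - smooth_sign y) <= 2 / k * cabs (x - y).
Proof.
have ne (u : R[i]) : (cabs u + k)%:C != 0 by rewrite -cabs_eq0 cabsk gt_eqF.
have -> : smooth_sign x - smooth_sign y =
    ((x - y) * (cabs y + k)%:C + y * (cabs y - cabs x)%:C) /
    ((cabs x + k)%:C * (cabs y + k)%:C).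
  rewrite (_ : cabs y - cabs x = (cabs y + k) - (cabs x + k)); last by ring.
  have frac (u v a b : R[i]) : u != 0 -> v != 0 ->
      a / u - b / v = ((a - b) * v + b * (v - u)) / (u * v).
    by move=> u0 v0; field; rewrite u0 v0.
  by rewrite rmorphB/= /smooth_sign frac.
rewrite cabsM cabsV cabsM !cabsk ler_pdivrMr ?mulr_gt0//.
apply: le_trans (cabsD _ _) _; rewrite !cabsM cabsk cabs_real.
have := lerB_cabs y x; rewrite [cabs (y - x)]cabsB => h.
apply: (@le_trans _ _ (cabs (x - y) * (cabs y + k) + (cabs y + k) * cabs (x - y))).
  by rewrite lerD2l// ler_pM ?cabs_ge0// lerDl ltW.
have ak : 1 <= (cabs x + k) / k by rewrite ler_pdivlMr// mul1r lerDr cabs_ge0.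
have -> : 2 / k * cabs (x - y) * ((cabs x + k) * (cabs y + k)) =
  cabs (x - y) * (cabs y + k) * 2 * ((cabs x + k) / k) by ring.
have -> : cabs (x - y) * (cabs y + k) + (cabs y + k) * cabs (x - y) =
  cabs (x - y) * (cabs y + k) * 2 by ring.
by rewrite ler_peMr// !mulr_ge0 ?cabs_ge0// ltW.
Qed.

(** Since (|x| - k)(|x| + k) <= |x|^2, pairing with the smoothed sign loses at most [k] against
    |x|. *)
Lemma smooth_sign_conj x : exists2 r : R, x^* * smooth_sign x = r%:C & cabs x - k <= r.
Proof.
exists (cabs x ^+ 2 / (cabs x + k)).
  by rewrite /smooth_sign mulrA [_^* * _]mulrC mulr_conj [RHS]rmorphM/= fmorphV.
by rewrite ler_pdivlMr// -subr_sqr gerBl sqr_ge0.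
Qed.

End SmoothSign.

Section MonomialLipschitz.
Context (R : realType) (n d : nat).
Implicit Types x y : 'I_n -> R[i].

(** The factors are exchanged one at a time; unimodularity keeps the remaining ones of modulus 1. *)
Lemma monA_lipschitz (A : {A : {set 'I_n} | #|A| == d}) x y (e : R) :
  unimodular x -> unimodular y -> (forall k, cabs (x k - y k) <= e) ->
  cabs (monA A x - monA A y) <= d%:R * e.
Proof.
move=> x1 y1 xy; rewrite /monA; case: A => A /= /eqP <-.
rewrite -!big_enum cardE; elim: (enum _) => [|k s IH].
  by rewrite !big_nil subrr cabs0 mul0r.
rewrite !big_cons /=; move: IH.
have : cabs (\prod_(j <- s) x j) = 1 by rewrite cabs_prod big1.
move: (\prod_(j <- s) x j) (\prod_(j <- s) y j) => px py px1 IH.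
have -> : x k * px - y k * py = (x k - y k) * px + y k * (px - py) by ring.
rewrite (le_trans (cabsD _ _))// !cabsM y1 mul1r px1 mulr1.
by rewrite -natr1 mulrDl mul1r [leRHS]addrC lerD.
Qed.

Lemma esym_lipschitz x y (e : R) :
  unimodular x -> unimodular y -> (forall k, cabs (x k - y k) <= e) ->
  cabs (esym d x - esym d y) <= #|{: {A : {set 'I_n} | #|A| == d}}|%:R * (d%:R * e).
Proof.
move=> x1 y1 xy; rewrite /esym -sumrB (le_trans (cabs_sum _ _ _))//.
rewrite mulr_natl -sumr_const; apply: ler_sum => A _; exact: monA_lipschitz.
Qed.

End MonomialLipschitz.

Section LowerBound.
Context (R : realType) (n d : nat).
Local Notation X := (tetra R n d).
Local Notation dset := {A : {set 'I_n} | #|A| == d}.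
Local Notation S := {z : 'I_n -> R[i] | unimodular z}.
Local Notation Y := (bfun_banach R S).

Let bounded_by (f : S -> R[i]) (M : R) : (forall s, cabs (f s) <= M) -> f \in @bounded_pred R S.
Proof. by move=> h; apply/asboolP; exists M. Qed.

Let emb_bounded (P : X) : (fun s : S => evalf P (sval s)) \in @bounded_pred R S.
Proof. by apply: (@bounded_by _ (tetra_norm P)) => s; exact/evalf_le_norm/(svalP s). Qed.

(** The functions live on the whole torus, since the values at finitely many tuples would not give
    the norm of [P] exactly. Boundedness suffices as regularity because all averages are finite. *)
Definition torus_emb (P : X) : Y := BFun (emb_bounded P).

Let torus_emb_linear : linear torus_emb.
Proof. by move=> a P Q; apply: bfun_ext => s; rewrite /= evalfP. Qed.

HB.instance Definition _ := GRing.isLinear.Build _ _ _ _ torus_emb torus_emb_linear.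

Lemma torus_emb_norm (P : X) : `|torus_emb P| = `|P|.
Proof.
rewrite bfun_normE; congr (_%:C); apply/eqP; rewrite eq_le; apply/andP; split.
  apply: bnorm_le => [|s]; first exact: tetra_norm_ge0.
  exact/evalf_le_norm/(svalP s).
apply: tetra_norm_torus => z z1.
exact: (bnorm_ub (torus_emb P) (exist _ z z1)).
Qed.

Section FixedProjection.
Context (k e C : R) (N : nat) (w : R[i]) (p : {linear Y -> Y}).
Local Notation G := {ffun 'I_n -> 'I_N.+1}.
Let M : R := #|{: dset}|%:R.
Let one : 'I_n -> R[i] := fun=> 1.
Hypotheses (k0 : 0 < k) (N0 : (0 < N)%N) (w_prim : N.+1.-primitive_root w).
Hypothesis dense : forall z, cabs z = 1 -> exists (m : 'I_N.+1) (s : R[i]),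
  [/\ z = w ^+ m * s, cabs s = 1 & cabs (s - 1) <= e].
Hypotheses (p_idem : forall y, p (p y) = p y) (p_range : range p = range torus_emb).
Hypothesis p_norm : (op_norm (p : Y -> Y) <= C%:E)%E.

Let one1 : unimodular one. Proof. by move=> i; exact: cabs1. Qed.

Let p_le (f : Y) (B : R) : 0 <= B -> (forall s, cabs (f s) <= B) ->
  forall s, cabs (p f s) <= C * B.
Proof.
move=> B0 fB s.
have fB' : bnorm f <= B by exact: bnorm_le.
have [f0|f0] := eqVneq (bnorm f) 0.
  have -> : f = 0 by apply/eqP; rewrite -normr_eq0 bfun_normE f0.
  rewrite linear0 -[(0 : Y) s]/(0 : R[i]) cabs0 mulr_ge0//.
  have := le_op_norm p_norm (v := 0); rewrite normr0 ler01 => /(_ isT).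
  by rewrite linear0 normr0 (ler_complex 0).
have fp : 0 < bnorm f by rewrite lt_def f0 bnorm_ge0.
have := le_op_norm p_norm (v := (bnorm f)^-1%:C *: f).
rewrite linearZ !normrZ !bfun_normE cabsE cabs_real ger0_norm ?invr_ge0 ?bnorm_ge0//.
rewrite -!rmorphM mulVf// => /(_ (lexx _)); rewrite ler_complex.
rewrite ler_pdivrMl// => h.
apply: le_trans (bnorm_ub (p f) s) _; apply: le_trans h _.
rewrite mulrC ler_wpM2l//.
have := le_op_norm p_norm (v := 0); rewrite normr0 ler01 => /(_ isT).
by rewrite linear0 normr0 (ler_complex 0).
Qed.

Let p_emb P : p (torus_emb P) = torus_emb P.
Proof.
have : range torus_emb (torus_emb P) by exists P.
by rewrite -p_range => -[y _ <-]; exact: p_idem.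
Qed.

Let C0 : 0 <= C.
Proof.
have := le_op_norm p_norm (v := 0); rewrite normr0 ler01 => /(_ isT).
by rewrite linear0 normr0 (ler_complex 0).
Qed.

Let rot (z : 'I_n -> R[i]) (z1 : unimodular z) (g : G) : S :=
  exist _ (zeta w z g) (zeta_unimodular w_prim g z1).

Let conj_rot1 (g : G) : unimodular (fun i => (zeta w one g i)^*).
Proof. by move=> i; rewrite cabsJ (zeta_unimodular w_prim). Qed.

Let coef (A : dset) (f : Y) : R[i] :=
  mean (fun g : G => (monA A (zeta w one g))^* * f (rot one1 g)).

Let coefD A f f' : coef A (f + f') = coef A f + coef A f'.
Proof. by rewrite /coef -meanD; apply: eq_mean => g; rewrite bfunD mulrDr. Qed.

Let coefZ A (a : R[i]) f : coef A (a *: f) = a * coef A f.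
Proof. by rewrite /coef -meanZ; apply: eq_mean => g; rewrite bfunZ mulrCA. Qed.

Let coef_le A (f : Y) (B : R) : (forall s, cabs (f s) <= B) -> cabs (coef A f) <= B.
Proof.
move=> fB; apply: le_trans (mean_cabs _) _.
rewrite -[leRHS](mean_const B (card_torus_gt0 n N)); apply: ler_mean => g.
by rewrite cabsM cabsJ cabs_monA ?mul1r//; exact: zeta_unimodular.
Qed.

Let coef_emb A P : coef A (torus_emb P) = tetra_coef P A.
Proof.
transitivity (mean (fun g : G => \sum_(B : dset) (tetra_coef P B *
    (monA B (zeta w one g) * (monA A (zeta w one g))^*)))).
  apply: eq_mean => g; rewrite /= /evalf mulr_sumr; apply: eq_bigr => B _.
  by rewrite mulrC mulrA.
rewrite mean_sum (bigD1 A)//= meanZ (mean_monA _ _ N0 w_prim)// eqxx mulr1.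
rewrite big1 ?addr0// => B BA; rewrite meanZ (mean_monA _ _ N0 w_prim)//.
by rewrite (negbTE BA) mulr0.
Qed.

Let h (z : 'I_n -> R[i]) : R[i] := smooth_sign k (esym d z).

Let h_bounded (g : G) : (fun s : S => h (zeta w (sval s) g)) \in @bounded_pred R S.
Proof. by apply: (@bounded_by _ 1) => s; exact: smooth_sign_le1. Qed.

Let tau g : Y := BFun (h_bounded g).

Let mono_emb (A : dset) : X := [ffun B => (B == A)%:R].

Let mono_embE A s : torus_emb (mono_emb A) s = monA A (sval s).
Proof.
rewrite /= /evalf (bigD1 A)//= /tetra_coef ffunE eqxx mul1r big1 ?addr0// => B BA.
by rewrite ffunE (negbTE BA) mul0r.
Qed.

(** The component of [h] of character [A] under translation by tuples. Over the full torus it would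
    be an exact multiple of the monomial; here [hAU] gives a multiplier that still depends on the
    coset. *)
Let hA (A : dset) : Y :=
  (#|{: G}|%:R : R[i])^-1 *: \sum_g (monA A (zeta w one g))^* *: tau g.

Let hAE A s : hA A s = mean (fun g : G => (monA A (zeta w one g))^* * h (zeta w (sval s) g)).
Proof.
rewrite /hA bfunZ /mean mulrC; congr (_ * _).
by elim/big_rec2: _ => // g u v _ <-.
Qed.

(* [U A z] is the [A]-th Fourier coefficient of [h] over the coset of [z]. *)
Let U (A : dset) (z : 'I_n -> R[i]) :=
  mean (fun g : G => (monA A (zeta w z g))^* * h (zeta w z g)).

Let zeta_split z (g : G) i : zeta w z g i = z i * zeta w one g i.
Proof. by rewrite /zeta mul1r. Qed.

Let hAU A s : hA A s = monA A (sval s) * U A (sval s).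
Proof.
rewrite hAE /U -meanZ; apply: eq_mean => g; rewrite [RHS]mulrA; congr (_ * _).
have -> : monA A (zeta w (sval s) g) = monA A (sval s) * monA A (zeta w one g).
  by rewrite -monAM; apply: eq_bigr => i _; rewrite zeta_split.
by rewrite rmorphM mulrA conj_unimodular ?mul1r// cabs_monA//; exact: (svalP s).
Qed.

(** Multiplying [z] by a tuple translates the summation variable; addition in ['I_N.+1] is modulo
    [N.+1], as are the exponents of [w]. *)
Let U_rot A z (m : 'I_n -> 'I_N.+1) : U A (fun i => w ^+ m i * z i) = U A z.
Proof.
pose s (g : G) : G := [ffun i => g i + m i].
have s_inj : injective s.
  by move=> g g' /ffunP gg; apply/ffunP => i; have := gg i; rewrite !ffunE => /addIr.
rewrite /U -(reindex_mean (fun g : G => (monA A (zeta w z g))^* * _) s_inj).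
apply: eq_mean => g /=.
suff -> : zeta w (fun i => w ^+ m i * z i) g = zeta w z (s g) by [].
apply/funext => i; rewrite /zeta ffunE (prim_expr_mod w_prim) exprD.
by rewrite mulrAC mulrC [_ ^+ m i * _]mulrC.
Qed.

(** The first term is the variation of a monomial at distance [e], the second that of [h]: the
    Lipschitz constant of the smoothed sign times the variation of e_d, a sum of [M] monomials. *)
Let delta : R := d%:R * e + 2 / k * (M * (d%:R * e)).

(** By density every coset has a representative within [e] of 1 in each coordinate, and [U A]
    depends on the coset only. *)
Let U_near A z : unimodular z -> cabs (U A z - U A one) <= delta.
Proof.
move=> z1; have /choice[m /choice[s hs]] := fun i => dense (z1 i).
have -> : z = fun i => w ^+ m i * s i by apply/funext => i; case: (hs i).
have s1 : unimodular s by move=> i; case: (hs i).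
rewrite U_rot /U -meanB; apply: le_trans (mean_cabs _) _.
rewrite -[leRHS](mean_const delta (card_torus_gt0 n N)); apply: ler_mean => g.
have zs := zeta_unimodular w_prim g s1; have zo := zeta_unimodular w_prim g one1.
have near_zeta i : cabs (zeta w s g i - zeta w one g i) <= e.
  rewrite /zeta -mulrBl cabsM cabsX (cabs_root w_prim) expr1n mulr1.
  by case: (hs i).
set x := zeta w s g; set y := zeta w one g.
have hx1 : cabs (h x) <= 1 by exact: smooth_sign_le1.
have hxy : cabs (h x - h y) <= 2 / k * (M * (d%:R * e)).
  apply: le_trans (smooth_sign_lipschitz k0 _ _) _.
  by rewrite ler_wpM2l ?divr_ge0 ?(ltW k0)// esym_lipschitz.
move: (h x) (h y) hx1 hxy => a b hx1 hxy.
have -> : (monA A x)^* * a - (monA A y)^* * b =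
    ((monA A x)^* - (monA A y)^*) * a + (monA A y)^* * (a - b) by ring.
apply: le_trans (cabsD _ _) _; rewrite !cabsM -rmorphB !cabsJ cabs_monA// mul1r.
apply: lerD => //; apply: le_trans (monA_lipschitz A zs zo near_zeta).
by rewrite ler_piMr ?cabs_ge0.
Qed.

Let e0 : 0 <= e.
Proof. by have [m [s [_ _]]] := dense (cabs1 R); apply: le_trans; exact: cabs_ge0. Qed.

Let delta0 : 0 <= delta.
Proof. by rewrite /delta /M addr_ge0 ?mulr_ge0 ?invr_ge0 ?ler0n ?e0 ?(ltW k0). Qed.

(** The projection fixes the monomial, so it acts only on the difference between [hA A] and its
    nearby multiple of that monomial. *)
Let coef_hA A : cabs (coef A (p (hA A)) - U A one) <= C * delta.
Proof.
pose err := hA A - U A one *: torus_emb (mono_emb A).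
have -> : hA A = U A one *: torus_emb (mono_emb A) + err by rewrite addrC subrK.
rewrite linearD linearZ/= p_emb coefD coefZ coef_emb /tetra_coef ffunE eqxx mulr1.
rewrite addrAC subrr add0r; apply/coef_le/p_le => // s.
have -> : err s = monA A (sval s) * (U A (sval s) - U A one).
  transitivity (hA A s - U A one * torus_emb (mono_emb A) s); first by [].
  by rewrite hAU mono_embE mulrBr [U A one * _]mulrC.
rewrite cabsM.
by rewrite cabs_monA ?mul1r; [apply: U_near|]; exact: (svalP s).
Qed.

Let range_expand (f : Y) : range torus_emb f ->
  forall s, f s = \sum_A coef A f * monA A (sval s).
Proof.
move=> [P _ <-] s; rewrite {1}/torus_emb/= /evalf; apply: eq_bigr => A _.
by rewrite coef_emb.
Qed.

Let coef_sum (A : dset) : mean (fun g : G => (monA A (zeta w one g))^* * coef A (p (tau g)))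
  = coef A (p (hA A)).
Proof.
rewrite /hA linearZ/= linear_sum coefZ /mean mulrC; congr (_ * _).
have -> : coef A (\sum_g p ((monA A (zeta w one g))^* *: tau g)) =
    \sum_g coef A (p ((monA A (zeta w one g))^* *: tau g)).
  apply: (big_morph _ (coefD A)).
  by have := coefZ A 0 0; rewrite scale0r mul0r.
by apply: eq_bigr => g _; rewrite linearZ/= coefZ.
Qed.

(* The sum is the mean over [g] of [p (tau g)] evaluated at the inverse of [g],
   that is, the averaged projection of [h] evaluated at 1. *)
Let trace_le : cabs (\sum_A coef A (p (hA A))) <= C.
Proof.
have -> : \sum_A coef A (p (hA A)) =
    mean (fun g : G => p (tau g) (exist _ _ (conj_rot1 g))).
  transitivity (mean (fun g => \sum_(A : dset) (monA A (zeta w one g))^* * coef A (p (tau g)))).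
    by rewrite mean_sum; apply: eq_bigr => A _; rewrite coef_sum.
  apply: eq_mean => g; rewrite range_expand.
    by apply: eq_bigr => A _; rewrite /= monAJ mulrC.
  by rewrite -p_range; exists (tau g).
apply: le_trans (mean_cabs _) _.
rewrite -[leRHS](mean_const C (card_torus_gt0 n N)); apply: ler_mean => g.
by rewrite -[leRHS]mulr1; apply: p_le => // s; exact: smooth_sign_le1.
Qed.

(** Summing over [A] pairs [h] with e_d itself, which recovers the mean of |e_d| up to the smoothing
    loss. *)
Let U_sum : mean (fun g : G => cabs (esym d (zeta w one g))) - k <= cabs (\sum_A U A one).
Proof.
have -> : \sum_A U A one = mean (fun g : G => (esym d (zeta w one g))^* * h (zeta w one g)).
  rewrite -mean_sum; apply: eq_mean => g.
  by rewrite -mulr_suml rmorph_sum.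
apply: le_trans (Re_le_cabs _); rewrite Re_mean.
rewrite -[X in _ - X](mean_const k (card_torus_gt0 n N)) -meanB; apply: ler_mean => g.
by have [r -> ] := smooth_sign_conj k0 (esym d (zeta w one g)).
Qed.

Lemma mean_le_projection : mean (fun g : G => cabs (esym d (zeta w one g))) - k <=
  C * (1 + M * delta).
Proof.
apply: le_trans U_sum _; rewrite -[\sum_A U A one](subrK (\sum_A coef A (p (hA A)))).
apply: le_trans (cabsD _ _) _; rewrite mulrDr mulr1 addrC lerD//.
rewrite -sumrB; apply: le_trans (cabs_sum _ _ _) _.
rewrite mulrCA /M mulr_natl -sumr_const; apply: ler_sum => A _.
by rewrite cabsB.
Qed.

End FixedProjection.

(** The roots are fixed before [C], so the coset error can only appear as a factor of [C]. Taking
    [C] strictly above the constant yields an actual projection of norm at most [C], without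
    assuming that the infimum is attained. *)
Lemma proj_const_ge (k : R) : 0 < k -> exists N (w : R[i]),
  [/\ (1 < N)%N, N.+1.-primitive_root w & forall C : R, (proj_const X < C%:E)%E ->
  mean (fun g : {ffun 'I_n -> 'I_N.+1} => cabs (esym d (zeta w (fun=> 1) g))) - k <= C * (1 + k)].
Proof.
move=> k0; pose M : R := #|{: dset}|%:R.
(* This is [M * delta] divided by [e]; with e = k / (1 + L) the total coset error is at most [k]. *)
pose L := M * (d%:R + 2 / k * (M * d%:R)).
have L0 : 0 <= L by rewrite /L /M ?(mulr_ge0, addr_ge0, ler0n, invr_ge0)// ltW.
have L1 : 0 < 1 + L by rewrite ltr_wpDr.
have e0 : 0 < k / (1 + L) by rewrite divr_gt0.
have [N [w [N1 w_prim dense]]] := roots_dense e0.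
exists N, w; split=> // C XC.
have : (rel_proj_const (range torus_emb) < C%:E)%E.
  apply: le_lt_trans XC; apply: ereal_sup_ubound.
  by exists Y, torus_emb; split=> //; exact: torus_emb_norm.
move=> /ereal_inf_lt[_ [p [_ p_idem p_range] <-] /ltW p_norm].
have h := mean_le_projection k0 (ltnW N1) w_prim dense p_idem p_range p_norm.
apply: le_trans h _.
have C0 : 0 <= C.
  have := le_op_norm p_norm (v := 0); rewrite normr0 ler01 => /(_ isT).
  by rewrite linear0 normr0 (ler_complex 0).
rewrite ler_wpM2l// lerD2l.
have -> : M * (d%:R * (k / (1 + L)) + 2 / k * (M * (d%:R * (k / (1 + L))))) =
  k * (L / (1 + L)) by rewrite /L; ring.
by rewrite ler_piMr ?(ltW k0)// ler_pdivrMr// mul1r lerDr.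
Qed.

End LowerBound.

(** * Lindeberg step for the heat flow *)

Section ExpBounds.
Context (R : realType).
Implicit Types x y p t : R.

Lemma derive_ge0_ge0 (f f' : R -> R) : (forall x, is_derive x 1 f (f' x)) ->
  f 0 = 0 -> (forall x, 0 <= x -> 0 <= f' x) -> forall x, 0 <= x -> 0 <= f x.
Proof.
move=> df f0 f'0 x; rewrite le_eqVlt => /predU1P[<-|x0]; first by rewrite f0.
have [|c cI] := MVT x0 (fun y _ => df y).
  apply: continuous_subspaceT => y; apply: differentiable_continuous.
  by apply/derivable1_diffP; have [] := df y.
rewrite f0 subr0 => ->; rewrite subr0 mulr_ge0//; last exact: ltW.
by apply: f'0; move: cI; rewrite in_itv/= => /andP[/ltW].
Qed.

Lemma expR_ge_deg2 x : 0 <= x -> 1 + x + x ^+ 2 / 2 <= expR x.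
Proof.
move=> x0; rewrite -subr_ge0.
apply: (@derive_ge0_ge0 (fun x => expR x - (1 + x + x ^+ 2 / 2)) (fun x => expR x - (1 + x))) => //.
- move=> y; apply: is_derive_eq.
  by rewrite /GRing.scale/=; field.
- by rewrite expR0 expr0n/=; lra.
- by move=> y _; rewrite subr_ge0 expR_ge1Dx.
Qed.

(** The product of 1 - x + x^2/2 and 1 + x + x^2/2 is 1 + x^4/4, hence at least 1. *)
Lemma expRN_le_deg2 x : 0 <= x -> expR (- x) <= 1 - x + x ^+ 2 / 2.
Proof.
move=> x0; rewrite expRN -div1r ler_pdivrMr ?expR_gt0//.
have h := expR_ge_deg2 x0.
have q0 : 0 <= 1 - x + x ^+ 2 / 2 by have := sqr_ge0 (1 - x); rewrite sqrrB; lra.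
apply: le_trans (ler_wpM2l q0 h).
have -> : (1 - x + x ^+ 2 / 2) * (1 + x + x ^+ 2 / 2) = 1 + (x ^+ 2 / 2) ^+ 2 by field.
by rewrite lerDl sqr_ge0.
Qed.

Lemma expRN_ge_deg3 x : 0 <= x -> 1 - x + x ^+ 2 / 2 - x ^+ 3 / 6 <= expR (- x).
Proof.
move=> x0; rewrite -subr_ge0.
apply: (@derive_ge0_ge0 (fun x => expR (- x) - (1 - x + x ^+ 2 / 2 - x ^+ 3 / 6))
   (fun x => 1 - x + x ^+ 2 / 2 - expR (- x))) => //.
- move=> y; apply: is_derive_eq.
  by rewrite /GRing.scale/=; field.
- by rewrite oppr0 expR0 !expr0n/=; lra.
- by move=> y y0; rewrite subr_ge0 expRN_le_deg2.
Qed.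

Lemma expR_le_deg1 x : 0 <= x -> expR x <= 1 + x + x ^+ 2 * expR x.
Proof.
move=> x0; have := expR_ge1Dx (- x); rewrite -(ler_pM2r (expR_gt0 x)).
rewrite -expRD addNr expR0 => h.
have x1 : 0 <= 1 + x by lra.
have := ler_wpM2l x1 h; rewrite mulr1.
have -> : (1 + x) * ((1 - x) * expR x) = expR x - x ^+ 2 * expR x by ring.
by lra.
Qed.

Lemma expR_Taylor2 y :
  `|expR y - (1 + y + y ^+ 2 / 2)| <= `|y| ^+ 3 * expR `|y|.
Proof.
have [y0|y0] := leP 0 y.
  rewrite !ger0_norm ?subr_ge0 ?expR_ge_deg2//.
  have [y1|y1] := leP 1 y.
    have : expR y <= y ^+ 3 * expR y by rewrite ler_peMl ?expR_ge0// exprn_ege1.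
    by have := sqr_ge0 y; lra.
  have := expRN_ge_deg3 y0; rewrite -(ler_pM2r (expR_gt0 y)) -expRD addNr expR0 => h.
  have q0 : 0 <= 1 + y + y ^+ 2 / 2 by have := sqr_ge0 y; lra.
  have := ler_wpM2l q0 h; rewrite mulr1.
  have -> : (1 + y + y ^+ 2 / 2) * ((1 - y + y ^+ 2 / 2 - y ^+ 3 / 6) * expR y) =
    expR y - (y ^+ 3 / 6 - y ^+ 4 / 12 + y ^+ 5 / 12) * expR y by field.
  have : (y ^+ 3 / 6 - y ^+ 4 / 12 + y ^+ 5 / 12) * expR y <= y ^+ 3 * expR y.
    rewrite ler_wpM2r ?expR_ge0//.
    have y3 : 0 <= y ^+ 3 by rewrite exprn_ge0.
    have y4 : 0 <= y ^+ 4 by rewrite exprn_ge0.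
    have : y ^+ 5 <= y ^+ 3 by rewrite ler_wiXn2l// ltW.
    by lra.
  by lra.
have x0 : 0 <= - y by lra.
rewrite [`|y|]ltr0_norm//.
have h1 := expRN_le_deg2 x0; have h2 := expRN_ge_deg3 x0.
rewrite !opprK sqrrN in h1 h2.
have x3 : 0 <= (- y) ^+ 3 by rewrite exprn_ge0.
have : (- y) ^+ 3 <= (- y) ^+ 3 * expR (- y) by rewrite ler_peMr// -expR0 ler_expR.
by move=> h3; rewrite ler_norml; apply/andP; split; lra.
Qed.

Lemma expR_le_quad y : `|y| <= 1 -> expR y <= 1 + y + (1 + expR 1) * y ^+ 2.
Proof.
move=> y1; have := expR_Taylor2 y; rewrite ler_norml => /andP[_ h].
have : `|y| ^+ 3 * expR `|y| <= y ^+ 2 * expR 1.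
  rewrite -(real_normK (num_real y)) ler_pM ?exprn_ge0 ?expR_ge0 ?ler_expR//.
  exact: ler_wiXn2l.
by have := sqr_ge0 y; lra.
Qed.

Lemma poly_expRN_le p : 0 <= p ->
  (1 + 2 * p) * expR (- p) <= 2 /\ p ^+ 2 * expR (- (p / 2)) <= 8.
Proof.
move=> p0; split.
  rewrite expRN ler_pdivrMr ?expR_gt0//; have := expR_ge1Dx p; lra.
rewrite expRN ler_pdivrMr ?expR_gt0//.
have p2 : 0 <= p / 2 by lra.
by have := expR_ge_deg2 p2; have := expR_gt0 (p / 2); lra.
Qed.

End ExpBounds.

(** * One increment of the walk against one time step of the heat flow *)

Section HeatStep.
Context (R : realType).

(* Both sides are compared with [(1 + t (p - 1)) e^-p], in the scaled variables
   [p = |x|^2 / c] and [t = dl^2 / c]. *)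
Lemma heat_time_step (p t : R) : 0 <= p -> 0 <= t <= 1 ->
  `|expR (- p) * (expR (- t) * (1 + t * p)) - expR (- (p / (1 + t))) / (1 + t)| <= 12 * t ^+ 2.
Proof.
move=> p0 /andP[t0 t1]; have [e1 e2] := poly_expRN_le p0.
have ep0 := expR_gt0 (- p).
have t2 := sqr_ge0 t.
have T2 : `|expR (- p) * (expR (- t) * (1 + t * p)) - expR (- p) * (1 + t * (p - 1))| <= 2 * t ^+ 2.
  rewrite -mulrBr normrM gtr0_norm//.
  have h1 := expRN_le_deg2 t0; have h2 := expR_ge1Dx (- t).
  have tp0 : 0 <= t * p by rewrite mulr_ge0.
  apply: (@le_trans _ _ (t ^+ 2 * ((1 + 2 * p) * expR (- p)))); last first.
    by rewrite mulrC ler_wpM2r.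
  rewrite mulrA mulrC ler_wpM2r ?(ltW ep0)//.
  have -> : expR (- t) * (1 + t * p) - (1 + t * (p - 1)) =
    (expR (- t) - 1 + t) * (1 + t * p) - t ^+ 2 * p by ring.
  have q0 : 0 <= expR (- t) - 1 + t by lra.
  have q1 : expR (- t) - 1 + t <= t ^+ 2 by lra.
  have tpp : t * p <= p by rewrite ler_piMl.
  have r0 : 0 <= (expR (- t) - 1 + t) * (1 + t * p) by rewrite mulr_ge0//; lra.
  have r1 : (expR (- t) - 1 + t) * (1 + t * p) <= t ^+ 2 * (1 + p).
    by rewrite ler_pM//; lra.
  have pp : 0 <= t ^+ 2 * p by rewrite mulr_ge0.
  by rewrite ler_norml; apply/andP; split; lra.
pose a := (1 + t)^-1.
have t10 : 1 + t != 0 by rewrite gt_eqF//; lra.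
have a0 : 0 < a by rewrite invr_gt0; lra.
have a1 : a <= 1 by rewrite invf_le1; lra.
have aE : a = 1 - t * a by rewrite /a; field.
(* The gap between the exponents: p / (1 + t) = p - m, so both sides share the factor exp (- p). *)
pose m := t * p * a.
have m0 : 0 <= m by rewrite !mulr_ge0// ltW.
have mtp : m <= t * p by rewrite ler_piMr// mulr_ge0.
have mE : - (p / (1 + t)) = - p + m by rewrite /m -/a {1}aE; ring.
have m2 : m ^+ 2 <= t ^+ 2 * p ^+ 2 by rewrite -exprMn ler_sqr ?nnegrE// mulr_ge0.
(* As t <= 1, half of the Gaussian decay survives, enough to absorb the factor p^2 of the
   remainder. *)
have emh : expR (- p) * expR m <= expR (- (p / 2)).
  rewrite -expRD -mE ler_expR lerN2 ler_wpM2l// lef_pV2 ?posrE; lra.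
have T3 : `|expR (- p) * (1 + t * (p - 1)) - expR (- (p / (1 + t))) / (1 + t)| <= 10 * t ^+ 2.
  rewrite mE expRD -/a -mulrA -mulrBr normrM gtr0_norm//.
  have em := expR_le_deg1 m0; have em1 := expR_ge1Dx m.
  pose q := expR m - 1 - m.
  have q0 : 0 <= q by rewrite /q; lra.
  have q1 : q <= m ^+ 2 * expR m by rewrite /q; lra.
  have -> : 1 + t * (p - 1) - expR m * a = - (t ^+ 2 * a) + t ^+ 2 * p * (a * (1 + a)) - a * q.
    have h1 : a = 1 - t + t ^+ 2 * a by rewrite {1}aE {1}aE; ring.
    have h2 : m = t * p - t * p * t * a by rewrite /m {1}aE; ring.
    have h3 : m * a = t * p - t ^+ 2 * p * (a * (1 + a)).
      rewrite h2 mulrBl; rewrite [t * p * a](_ : _ = m)// h2; ring.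
    have -> : expR m = 1 + m + q by rewrite /q; ring.
    have -> : (1 + m + q) * a = a + m * a + a * q by ring.
    by rewrite h3 {1}h1; ring.
  apply: (@le_trans _ _ (expR (- p) * (t ^+ 2 * (1 + 2 * p) + t ^+ 2 * p ^+ 2 * expR m))).
    rewrite ler_wpM2l ?(ltW ep0)//.
    have s1 : 0 <= t ^+ 2 * a <= t ^+ 2.
      by rewrite mulr_ge0 ?(ltW a0)//= ler_piMr.
    have aa : 0 <= a * (1 + a) <= 2.
      by rewrite mulr_ge0 ?addr_ge0 ?(ltW a0)//=; nra.
    have tp2 : 0 <= t ^+ 2 * p by rewrite mulr_ge0.
    have s2 : 0 <= t ^+ 2 * p * (a * (1 + a)) <= t ^+ 2 * p * 2.
      by case/andP: aa => aa0 aa1; rewrite mulr_ge0//= ler_wpM2l.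
    have s3 : 0 <= a * q <= t ^+ 2 * p ^+ 2 * expR m.
      rewrite mulr_ge0 ?(ltW a0)//=; apply: le_trans (_ : q <= _); first by rewrite ler_piMl.
      by apply: le_trans q1 _; rewrite ler_wpM2r ?expR_ge0.
    move: s1 s2 s3 => /andP[? ?] /andP[? ?] /andP[? ?].
    by rewrite ler_norml; apply/andP; split; lra.
  have -> : expR (- p) * (t ^+ 2 * (1 + 2 * p) + t ^+ 2 * p ^+ 2 * expR m) =
    t ^+ 2 * ((1 + 2 * p) * expR (- p) + p ^+ 2 * (expR (- p) * expR m)) by ring.
  rewrite mulrC ler_wpM2r//.
  have : p ^+ 2 * (expR (- p) * expR m) <= p ^+ 2 * expR (- (p / 2)).
    by rewrite ler_wpM2l ?sqr_ge0.
  by lra.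
have := ler_distD (expR (- p) * (1 + t * (p - 1)))
  (expR (- p) * (expR (- t) * (1 + t * p))) (expR (- (p / (1 + t))) / (1 + t)).
by lra.
Qed.

(** The growth exp |y| is at most exp (1 + sg^2 / 2), leaving exp (- sg^2 / 2) to absorb sg^3. The
    constant 72 is 8, from the cube of 2 ta sg, times the bound 9 for sg^3 exp (- sg^2 / 2). *)
Lemma heat_space_step (sg ta y : R) : 0 <= sg -> 0 <= ta <= 1 / 4 ->
  `|y| <= 2 * ta * sg ->
  expR (- sg ^+ 2) * `|expR y - (1 + y + y ^+ 2 / 2)| <= 72 * expR 1 * ta ^+ 3.
Proof.
move=> sg0 /andP[ta0 ta1] yb.
apply: (@le_trans _ _ (expR (- sg ^+ 2) * ((2 * ta * sg) ^+ 3 * (expR 1 * expR (sg ^+ 2 / 2))))).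
  rewrite ler_wpM2l ?expR_ge0//; apply: le_trans (expR_Taylor2 y) _.
  rewrite ler_pM ?exprn_ge0 ?expR_ge0//.
    by rewrite lerXn2r ?nnegrE// (le_trans _ yb).
  rewrite -expRD ler_expR; apply: le_trans yb _.
  have : ta * sg <= 1 / 4 * sg by rewrite ler_wpM2r.
  by have := sqr_ge0 (sg - 1 / 2); rewrite sqrrB; lra.
have e1 : expR (- sg ^+ 2) * expR (sg ^+ 2 / 2) = expR (- (sg ^+ 2 / 2)).
  by rewrite -expRD; congr expR; field.
have -> : expR (- sg ^+ 2) * ((2 * ta * sg) ^+ 3 * (expR 1 * expR (sg ^+ 2 / 2))) =
  8 * expR 1 * ta ^+ 3 * (sg ^+ 3 * expR (- (sg ^+ 2 / 2))) by rewrite -e1; ring.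
have -> : 72 * expR 1 * ta ^+ 3 = 8 * expR 1 * ta ^+ 3 * 9 by ring.
rewrite ler_wpM2l ?mulr_ge0 ?expR_ge0 ?exprn_ge0//.
have [_ h] := poly_expRN_le (sqr_ge0 sg).
have e0 := expR_ge0 (- (sg ^+ 2 / 2)).
have e2 : expR (- (sg ^+ 2 / 2)) <= 1 by rewrite -expR0 ler_expR oppr_le0 divr_ge0 ?sqr_ge0.
have : sg ^+ 3 <= 1 + (sg ^+ 2) ^+ 2.
  have [sg1|sg1] := leP sg 1.
    by have := exprn_ile1 3 sg0 sg1; have := sqr_ge0 (sg ^+ 2); lra.
  by rewrite -exprM; have := ler_weXn2l (ltW sg1) (leqnSn 3); lra.
move=> /(ler_wpM2r e0); rewrite mulrDl mul1r; lra.
Qed.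

(* [heat c (|x|^2)] is, up to a constant, the heat kernel at time [c]: its mean
   under a centered complex Gaussian shift of variance [t] is
   [heat (c + t) (|x|^2)]. *)
Definition heat (c r : R) : R := c^-1 * expR (- (r / c)).

(** A pointwise estimate prepared for averaging: the correction terms are real parts of multiples of
    [z] and [z ^+ 2] whose coefficients depend on [x] only, so they average to zero and leave a
    cubic error. *)
Lemma heat_step (s c dl W : R) (x z : R[i]) : 1 <= s -> s^-1 <= c -> 0 <= dl ->
  s * dl <= 1 / 4 -> cabs z = 1 ->
  W = c^-1 * expR (- (cabs x ^+ 2 / c)) * expR (- (dl ^+ 2 / c)) ->
  `|heat c (cabs (x + dl%:C * z) ^+ 2) - heat (c + dl ^+ 2) (cabs x ^+ 2)
    + W * (2 * dl / c) * complex.Re (x^* * z)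
    - W * (dl ^+ 2 / c ^+ 2) * complex.Re ((x^* * z) ^+ 2)| <=
  s ^+ 4 * (72 * expR 1 + 12) * dl ^+ 3.
Proof.
move=> s1 sc dl0 sdl z1 WE.
have s0 : 0 < s by lra.
have c0 : 0 < c by apply: lt_le_trans sc; rewrite invr_gt0.
have cs : c^-1 <= s by rewrite -[s]invrK lef_pV2 ?posrE// invr_gt0.
(* Rescaling by [q] reduces to heat time 1; the four powers of [s] in the bound come from the
   prefactor 1/c and the cube of [ta], which is at most s dl. *)
pose q := Num.sqrt c^-1.
have q2 : q ^+ 2 = c^-1 by rewrite sqr_sqrtr// invr_ge0 ltW.
have q0 : 0 <= q by rewrite sqrtr_ge0.
have qs : q <= s.
  by rewrite -ler_sqr ?nnegrE ?(ltW s0)// q2 (le_trans cs)// expr2 ler_peMl// ltW.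
pose ta := dl * q; pose sg := cabs x * q.
have ta0 : 0 <= ta by rewrite mulr_ge0.
have tas : ta <= s * dl by rewrite /ta [s * _]mulrC ler_wpM2l.
have sg0 : 0 <= sg by rewrite mulr_ge0 ?cabs_ge0.
set u := x^* * z.
have cu : cabs u = cabs x by rewrite cabsM z1 mulr1 cabsJ.
pose y := - (2 * dl / c) * complex.Re u.
have normE : cabs (x + dl%:C * z) ^+ 2 = cabs x ^+ 2 + 2 * dl * complex.Re u + dl ^+ 2.
  have -> : dl ^+ 2 = dl ^+ 2 * cabs z ^+ 2 by rewrite z1 expr1n mulr1.
  rewrite !cabs_sqr /u; case: (x) (z) => a b [a' b'] /=; ring.
(* The second-order Taylor term thus splits into a part with zero mean and a multiple of |x|^2,
   which the time step accounts for. *)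
have ReE : complex.Re (u ^+ 2) = 2 * complex.Re u ^+ 2 - cabs x ^+ 2.
  by rewrite -cu cabs_sqr expr2; case: (u) => a b /=; ring.
have yb : `|y| <= 2 * ta * sg.
  have k0 : 0 <= 2 * dl / c by rewrite ?mulr_ge0 ?invr_ge0 ?(ltW c0).
  rewrite normrM normrN (ger0_norm k0).
  have -> : 2 * ta * sg = 2 * dl / c * cabs x by rewrite /ta /sg -q2; ring.
  by rewrite ler_wpM2l// -cu normr_Re_le.
have h1 := heat_space_step sg0 (_ : 0 <= ta <= 1 / 4) yb.
have {}h1 := h1 (introT andP (conj ta0 (le_trans tas sdl))).
have h2 := heat_time_step (sqr_ge0 sg) (_ : 0 <= ta ^+ 2 <= 1).
have ta21 : 0 <= ta ^+ 2 <= 1 by rewrite sqr_ge0/= expr_le1//; lra.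
move: (h2 ta21) => {}h2.
have pE : cabs x ^+ 2 / c = sg ^+ 2 by rewrite /sg exprMn q2.
have tE : dl ^+ 2 / c = ta ^+ 2 by rewrite /ta exprMn q2.
have cd : c + dl ^+ 2 = c * (1 + ta ^+ 2) by rewrite -tE; field; rewrite gt_eqF.
have t10 : 1 + ta ^+ 2 != 0 by rewrite gt_eqF// ltr_pwDl ?sqr_ge0.
have E1 : heat c (cabs (x + dl%:C * z) ^+ 2) =
    c^-1 * (expR (- sg ^+ 2) * expR (- ta ^+ 2) * expR y).
  rewrite /heat normE -!expRD; congr (_ * expR _).
  by rewrite -pE -tE /y; field; rewrite gt_eqF.
have E2 : heat (c + dl ^+ 2) (cabs x ^+ 2) =
    c^-1 * (expR (- (sg ^+ 2 / (1 + ta ^+ 2))) / (1 + ta ^+ 2)).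
  rewrite /heat cd -pE.
  have -> : cabs x ^+ 2 / (c * (1 + ta ^+ 2)) = cabs x ^+ 2 / c / (1 + ta ^+ 2).
    by rewrite invfM mulrA.
  by rewrite invfM; move: (expR _) => E; ring.
have E3 : W * (2 * dl / c) * complex.Re u =
    c^-1 * (expR (- sg ^+ 2) * expR (- ta ^+ 2) * - y).
  by rewrite WE pE tE /y; ring.
have E4 : W * (dl ^+ 2 / c ^+ 2) * complex.Re (u ^+ 2) =
    c^-1 * (expR (- sg ^+ 2) * expR (- ta ^+ 2) * (y ^+ 2 / 2 - ta ^+ 2 * sg ^+ 2)).
  have -> : y ^+ 2 / 2 - ta ^+ 2 * sg ^+ 2 =
      dl ^+ 2 / c ^+ 2 * (2 * complex.Re u ^+ 2 - cabs x ^+ 2).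
    by rewrite /y -pE -tE; field; rewrite gt_eqF.
  by rewrite WE pE tE ReE; ring.
rewrite E1 E2 E3 E4.
have -> : c^-1 * (expR (- sg ^+ 2) * expR (- ta ^+ 2) * expR y) -
 c^-1 * (expR (- (sg ^+ 2 / (1 + ta ^+ 2))) / (1 + ta ^+ 2)) +
 c^-1 * (expR (- sg ^+ 2) * expR (- ta ^+ 2) * - y) -
 c^-1 * (expR (- sg ^+ 2) * expR (- ta ^+ 2) * (y ^+ 2 / 2 - ta ^+ 2 * sg ^+ 2)) =
 c^-1 * (expR (- ta ^+ 2) * (expR (- sg ^+ 2) * (expR y - (1 + y + y ^+ 2 / 2))) +
   (expR (- sg ^+ 2) * (expR (- ta ^+ 2) * (1 + ta ^+ 2 * sg ^+ 2)) -
    expR (- (sg ^+ 2 / (1 + ta ^+ 2))) / (1 + ta ^+ 2))) by ring.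
rewrite normrM ger0_norm ?invr_ge0 ?(ltW c0)//.
have -> : s ^+ 4 * (72 * expR 1 + 12) * dl ^+ 3 = s * ((72 * expR 1 + 12) * (s * dl) ^+ 3) by ring.
rewrite ler_pM ?invr_ge0 ?(ltW c0)//.
have e1 := expR_gt0 (1 : R).
apply: (@le_trans _ _ ((72 * expR 1 + 12) * ta ^+ 3)); last first.
  apply: ler_wpM2l; first by lra.
  by rewrite lerXn2r ?nnegrE// (le_trans _ tas).
apply: le_trans (ler_normD _ _) _; rewrite mulrDl lerD//.
  rewrite normrM ger0_norm ?expR_ge0//; apply: le_trans h1.
  rewrite normrM ger0_norm ?expR_ge0// ler_piMl ?mulr_ge0 ?expR_ge0//.
  by rewrite -expR0 ler_expR oppr_le0 sqr_ge0.
apply: le_trans h2 _; rewrite -exprM ler_wpM2l// ler_wiXn2l//; lra.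
Qed.

End HeatStep.

(** * Random walks of roots of unity *)

Section MeanBounds.
Context (R : realType) (T : finType).
Hypothesis T0 : (0 < #|T|)%N.

Lemma mean_le_const (f : T -> R) (K : R) : (forall t, f t <= K) -> mean f <= K.
Proof. by move=> fK; rewrite -[leRHS](mean_const K T0); exact: ler_mean. Qed.

Lemma mean_norm_le_const (f : T -> R) (K : R) :
  (forall t, `|f t| <= K) -> `|mean f| <= K.
Proof.
move=> fK; rewrite ler_norml; apply/andP; split; last first.
  by apply: mean_le_const => t; exact: le_trans (ler_norm _) (fK t).
rewrite lerNl -meanN; apply: mean_le_const => t.
by apply: le_trans (fK t); rewrite -normrN ler_norm.
Qed.

End MeanBounds.

Section Walk.
Context (R : realType) (n N : nat) (w : R[i]) (z : 'I_n -> R[i]).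
Hypotheses (n0 : (0 < n)%N) (N1 : (1 < N)%N) (w_prim : N.+1.-primitive_root w).
Hypothesis z1 : unimodular z.
Local Notation G := {ffun 'I_n -> 'I_N.+1}.
Implicit Types (g : G) (k : 'I_n) (m : nat).

Let zt (g : G) := zeta w z g.
Let zt1 g : unimodular (zt g). Proof. exact: zeta_unimodular. Qed.
Let G0 : (0 < #|{: G}|)%N. Proof. exact: card_torus_gt0. Qed.

Let rho : R := Num.sqrt n%:R.
Let dl : R := rho^-1.

Let rho0 : 0 < rho. Proof. by rewrite sqrtr_gt0 ltr0n. Qed.
Let rho2 : rho ^+ 2 = n%:R. Proof. by rewrite sqr_sqrtr ?ler0n. Qed.
Let dl0 : 0 < dl. Proof. by rewrite invr_gt0. Qed.
Let dl2 : n%:R * dl ^+ 2 = 1.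
Proof. by rewrite -rho2 -exprMn divff ?expr1n// gt_eqF. Qed.

Definition walk m g : R[i] :=
  ((Num.sqrt n%:R)^-1)%:C * \sum_(i < n | (i < m)%N) zeta w z g i.

Lemma walk0 g : walk 0 g = 0.
Proof. by rewrite /walk big_pred0 ?mulr0. Qed.

Lemma walkS k g : walk k.+1 g = walk k g + dl%:C * zt g k.
Proof.
rewrite /walk (bigD1 k)//= mulrDr addrC; congr (_ * _ + _).
by apply: eq_bigl => i; rewrite ltnS ltn_neqAle andbC.
Qed.

Let walk_shift k g : walk k (shift k g) = walk k g.
Proof.
rewrite /walk; congr (_ * _); apply: eq_bigr => i ik.
by rewrite (zeta_shift w_prim); case: eqP ik => [->|_ _]; rewrite ?ltnn// mul1r.
Qed.

(** The replacement for independent increments: rotating coordinate [k] leaves [walk k] unchanged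
    and multiplies the power by w^e, which differs from 1 for e = 1, 2 since the order is at least
    3. *)
Let mean_walk0 (F : R[i] -> R[i]) k (e : nat) : (0 < e <= 2)%N ->
  mean (fun g => F (walk k g) * zt g k ^+ e) = 0.
Proof.
move=> e12; apply: (@mean_eigen0 _ _ (shift k) (w ^+ e)).
- exact: shift_inj.
- rewrite -[X in _ != X](expr0 w) (eq_prim_root_expr w_prim) !modn_small//.
    by case: e e12.
  by case/andP: e12 => _ /leq_ltn_trans; apply; rewrite ltnS.
- by move=> g; rewrite walk_shift /zt (zeta_shift w_prim) eqxx exprMn mulrCA.
Qed.

Let mean_Re_walk0 (F : R[i] -> R[i]) k (e : nat) : (0 < e <= 2)%N ->
  mean (fun g => complex.Re (F (walk k g) * zt g k ^+ e)) = 0.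
Proof. by move=> e12; rewrite -Re_mean mean_walk0. Qed.

Let heat_walk_step (s : R) k (c : R) : 1 <= s -> s^-1 <= c -> s * dl <= 1 / 4 ->
  `|mean (fun g => heat c (cabs (walk k.+1 g) ^+ 2))
    - mean (fun g => heat (c + dl ^+ 2) (cabs (walk k g) ^+ 2))| <=
  s ^+ 4 * (72 * expR 1 + 12) * dl ^+ 3.
Proof.
move=> s1 sc sdl.
pose W (x : R[i]) : R := c^-1 * expR (- (cabs x ^+ 2 / c)) * expR (- (dl ^+ 2 / c)).
pose F1 (x : R[i]) : R[i] := (W x * (2 * dl / c))%:C * x^*.
pose F2 (x : R[i]) : R[i] := (W x * (dl ^+ 2 / c ^+ 2))%:C * (x^*) ^+ 2.
have h1 : mean (fun g => complex.Re (F1 (walk k g) * zt g k ^+ 1)) = 0.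
  exact: mean_Re_walk0.
have h2 : mean (fun g => complex.Re (F2 (walk k g) * zt g k ^+ 2)) = 0.
  exact: mean_Re_walk0.
(* The corrections of [heat_step] enter as means known to be zero, so that the estimate applies
   pointwise. *)
rewrite -[X in `|X|]addr0 -[X in `|X|]addr0 -{1}h1 -{1}oppr0 -h2 -!meanB -meanD -meanB.
apply: mean_norm_le_const => // g.
have := heat_step s1 sc (ltW dl0) sdl (zt1 g k) (erefl (W (walk k g))).
rewrite -walkS; congr (`|_| <= _); congr (_ + _ - _).
  by rewrite /F1 expr1 -ReZ; congr (complex.Re _); exact: mulrA.
by rewrite /F2 -ReZ exprMn; congr (complex.Re _); exact: mulrA.
Qed.

(** Lindeberg telescoping: each increment of variance 1/n is traded for heat time 1/n. The times
    never fall below 1/s, so the cost per step is uniform. *)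
Lemma heat_walk (s : R) m : 1 <= s -> s / Num.sqrt n%:R <= 1 / 4 -> (m <= n)%N ->
  `|mean (fun g => heat (s^-1 + (n - m)%:R * dl ^+ 2) (cabs (walk m g) ^+ 2))
    - heat (s^-1 + 1) 0| <= m%:R * (s ^+ 4 * (72 * expR 1 + 12) * dl ^+ 3).
Proof.
move=> s1 sdl; elim: m => [|m IH] mn.
  rewrite subn0 dl2 mul0r (eq_mean (g := fun=> heat (s^-1 + 1) 0)).
    by rewrite mean_const// subrr normr0.
  by move=> g; rewrite walk0 cabs0 expr0n.
pose k := Ordinal mn.
have c0 : s^-1 <= s^-1 + (n - m.+1)%:R * dl ^+ 2.
  by rewrite lerDl mulr_ge0 ?ler0n ?sqr_ge0.
have := heat_walk_step k s1 c0 sdl.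
have -> : s^-1 + (n - m.+1)%:R * dl ^+ 2 + dl ^+ 2 = s^-1 + (n - m)%:R * dl ^+ 2.
  by rewrite -[in RHS]subnSK// -natr1; ring.
move: (IH (ltnW mn)) => /=.
set A := mean _; set B := mean _; set H := heat _ _ => h1 h2.
rewrite -natr1 mulrDl mul1r.
have -> : B - H = (A - H) + (B - A) by ring.
apply: le_trans (ler_normD _ _) _; exact: lerD.
Qed.

(** At heat time 1/s the kernel is s exp (- s |x|^2), while the starting value at the origin is s /
    (1 + s). The n cubic errors of order n^(-3/2) add up to n^(-1/2), and dividing by [s] leaves its
    cube. *)
Lemma laplace_walk (s : R) : 1 <= s -> s / Num.sqrt n%:R <= 1 / 4 ->
  `|mean (fun g => expR (- (s * cabs (walk n g) ^+ 2))) - (1 + s)^-1| <=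
  s ^+ 3 * (72 * expR 1 + 12) / Num.sqrt n%:R.
Proof.
move=> s1 sdl; have s0 : 0 < s by lra.
have := heat_walk s1 sdl (leqnn n).
rewrite subnn mul0r addr0 /heat mul0r oppr0 expR0 mulr1.
rewrite (eq_mean (g := fun g => s * expR (- (s * cabs (walk n g) ^+ 2)))); last first.
  by move=> g; rewrite invrK; congr (_ * expR (- _)); rewrite mulrC.
rewrite meanZ.
have -> : (s^-1 + 1)^-1 = s * (1 + s)^-1.
  by field; rewrite !gt_eqF//; lra.
rewrite -mulrBr normrM gtr0_norm// -ler_pdivlMl//.
move/le_trans; apply; rewrite le_eqVlt; apply/orP; left; apply/eqP.
by rewrite -/rho -rho2 /dl; field; rewrite !gt_eqF.
Qed.

(** The linear term of each increment has zero mean, so one step multiplies the moment by at most 1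
    + (1 + exp 1) / n. *)
Lemma exp_moment_walk (u : R[i]) m : cabs u = 1 -> (m <= n)%N ->
  mean (fun g => expR (complex.Re (u * walk m g))) <= (1 + (1 + expR 1) * dl ^+ 2) ^+ m.
Proof.
move=> u1; elim: m => [|m IH] mn.
  rewrite (eq_mean (g := fun=> 1)) ?mean_const// => g.
  by rewrite walk0 mulr0 expR0.
pose k := Ordinal mn; pose q := 1 + (1 + expR 1) * dl ^+ 2.
have q0 : 0 <= q by rewrite addr_ge0// mulr_ge0 ?sqr_ge0// addr_ge0// expR_ge0.
pose F (x : R[i]) : R[i] := (expR (complex.Re (u * x)) * dl)%:C * u.
have dl1 : dl <= 1.
  by rewrite invf_le1// -sqrtr1 ler_wsqrtr// ler1n.
apply: (@le_trans _ _ (q * mean (fun g => expR (complex.Re (u * walk k g)))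
   + mean (fun g => complex.Re (F (walk k g) * zt g k ^+ 1)))); last first.
  rewrite mean_Re_walk0// addr0 exprS ler_wpM2l//; exact: IH (ltnW mn).
rewrite -meanZ -meanD; apply: ler_mean => g.
rewrite (walkS k) mulrDr ReD expRD expr1 /F -mulrA ReZ.
have -> : u * (dl%:C * zt g k) = dl%:C * (u * zt g k) by rewrite mulrCA.
rewrite ReZ; set E := expR _; set r := complex.Re (u * zt g k).
have r1 : `|r| <= 1 by rewrite (le_trans (normr_Re_le _))// cabsM u1 zt1 mulr1.
have y1 : `|dl * r| <= dl.
  by rewrite normrM gtr0_norm// ler_piMr// ltW.
have y2 : (dl * r) ^+ 2 <= dl ^+ 2.
  by rewrite -(real_normK (num_real _)) lerXn2r ?nnegrE ?(ltW dl0).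
have -> : q * E + E * dl * r = E * (q + dl * r) by ring.
rewrite ler_wpM2l ?expR_ge0//; apply: le_trans (expR_le_quad (le_trans y1 dl1)) _.
rewrite /q addrAC lerD2r lerD2l ler_wpM2l// addr_ge0// expR_ge0.
Qed.


Lemma exp_moment_le (u : R[i]) : cabs u = 1 ->
  mean (fun g => expR (complex.Re (u * walk n g))) <= expR (1 + expR 1).
Proof.
move=> u1; apply: le_trans (exp_moment_walk u1 (leqnn n)) _.
have E : 1 + expR 1 = n%:R * ((1 + expR 1) * dl ^+ 2) :> R.
  by rewrite mulrCA dl2 mulr1.
have q0 : 0 <= (1 + expR 1) * dl ^+ 2.
  by rewrite mulr_ge0 ?sqr_ge0// addr_ge0// expR_ge0.
by rewrite [X in _ <= expR X]E expRM_natl lerXn2r ?nnegrE ?expR_ge0 ?addr_ge0// expR_ge1Dx.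
Qed.

(** Here |x| is at most twice the larger of its real and imaginary parts, a power r^M is at most M!
    exp r, and the four directions 1, -1, i, -i each contribute an exponential moment. *)
Definition moment_bound (M : nat) : R := 2 ^+ M * (M`!%:R * (4 * expR (1 + expR 1))).

Lemma exprn_le_expR (x : R) M : 0 <= x -> x ^+ M <= M`!%:R * expR x.
Proof.
move=> x0; have f0 : 0 < M`!%:R :> R by rewrite ltr0n fact_gt0.
case: M f0 => [|M] f0; first by rewrite expr0 fact0 mul1r -expR0 ler_expR.
by rewrite -ler_pdivrMl// mulrC (le_trans _ (expR_ge1Dxn M x0))// lerDr.
Qed.

Lemma exprn_norm_le_expR (x : R) M : `|x| ^+ M <= M`!%:R * (expR x + expR (- x)).
Proof.
apply: le_trans (exprn_le_expR M (normr_ge0 x)) _; rewrite ler_wpM2l ?ler0n//.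
have [x0|x0] := leP 0 x; first by rewrite ger0_norm// lerDl expR_ge0.
by rewrite ltr0_norm// lerDr expR_ge0.
Qed.

Lemma moment_walk M : mean (fun g => cabs (walk n g) ^+ M) <= moment_bound M.
Proof.
have key (x : R[i]) : cabs x ^+ M <= 2 ^+ M * (M`!%:R *
    (expR (complex.Re (1 * x)) + expR (complex.Re (- 1 * x)) +
     (expR (complex.Re ('i * x)) + expR (complex.Re (- 'i * x))))).
  have -> : complex.Re (1 * x) = complex.Re x by rewrite mul1r.
  have -> : complex.Re (- 1 * x) = - complex.Re x.
    by rewrite mulN1r; case: x.
  have -> : complex.Re ('i * x) = - complex.Im x.
    by case: x => a b /=; rewrite mul0r mul1r sub0r.
  have -> : complex.Re (- 'i * x) = complex.Im x.
    by case: x => a b /=; rewrite oppr0 mul0r mulN1r sub0r opprK.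
  set a := complex.Re x; set b := complex.Im x.
  apply: (@le_trans _ _ ((2 * Num.max `|a| `|b|) ^+ M)).
    rewrite lerXn2r ?nnegrE ?cabs_ge0 ?mulr_ge0 ?le_max ?normr_ge0//.
    by rewrite mulr_natl mulr2n; apply: cabs_le_ReIm; rewrite le_max lexx ?orbT.
  rewrite exprMn ler_wpM2l ?exprn_ge0//.
  have ha := exprn_norm_le_expR a M; have hb := exprn_norm_le_expR b M.
  rewrite mulrDr; set X := M`!%:R * (expR a + _) in ha *.
  rewrite [expR (- b) + _]addrC; set Z := M`!%:R * (expR b + _) in hb *.
  have X0 : 0 <= X by rewrite mulr_ge0 ?ler0n ?addr_ge0 ?expR_ge0.
  have Z0 : 0 <= Z by rewrite mulr_ge0 ?ler0n ?addr_ge0 ?expR_ge0.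
  by case: (leP `|a| `|b|) => _; [apply: le_trans hb _|apply: le_trans ha _]; rewrite ?lerDl ?lerDr.
apply: le_trans (ler_mean (fun g => key (walk n g))) _.
rewrite !meanZ !meanD ler_wpM2l ?exprn_ge0// ler_wpM2l ?ler0n//.
have i1 : cabs ('i : R[i]) = 1.
  by rewrite /cabs /= expr0n/= add0r expr1n sqrtr1.
have h1 := exp_moment_le (cabs1 R).
have h2 : mean (fun g => expR (complex.Re (- 1 * walk n g))) <= expR (1 + expR 1).
  by apply: exp_moment_le; rewrite cabsN cabs1.
have h3 := exp_moment_le i1.
have h4 : mean (fun g => expR (complex.Re (- 'i * walk n g))) <= expR (1 + expR 1).
  by apply: exp_moment_le; rewrite cabsN i1.
lra.
Qed.

End Walk.

(** * Elementary symmetric polynomials of random roots of unity *)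

Section ElementarySymmetric.
Context (R : realType) (n : nat).
Implicit Types (x : 'I_n -> R[i]) (A B : {set 'I_n}).

Lemma esymE d x : esym d x = \sum_(A : {set 'I_n} | #|A| == d) \prod_(j in A) x j.
Proof.
by rewrite /esym /monA; symmetry;
  exact: (big_sub [pred A : {set 'I_n} | #|A| == d] (fun A => \prod_(j in A) x j)).
Qed.

(* The part of [e_1 e_d] in which one variable is squared; its monomials are
   orthonormal as soon as the roots of unity have order at least 3. *)
Definition esym_rest d x : R[i] :=
  \sum_(p : {set 'I_n} * 'I_n | (#|p.1| == d) && (p.2 \in p.1))
    mono (fun k => (k \in p.1) + (k == p.2))%N x.

Lemma esym0 x : esym 0 x = 1.
Proof.
rewrite esymE (big_pred1 finset.set0); first by rewrite big_set0.
by move=> A; rewrite /= cards_eq0.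
Qed.

(** In the product, pairs of a [d]-set and an index outside it yield each (d + 1)-set d + 1 times,
    once per removed element; an index inside the set gives the squared variable. *)
Lemma esym_rec d x :
  (\sum_i x i) * esym d x = d.+1%:R * esym d.+1 x + esym_rest d x.
Proof.
rewrite mulrC [in LHS]esymE mulr_suml.
under eq_bigr => A _ do rewrite mulr_sumr.
rewrite pair_big_dep/= (bigID (fun p : {set 'I_n} * 'I_n => p.2 \in p.1))/= addrC.
congr (_ + _); last first.
  apply: eq_big => [p|[A j] /= /andP[_ jA]]; first by rewrite andbT.
  rewrite prod_mono /mono [RHS](eq_bigr (fun k => x k ^+ (k \in A) * x k ^+ (k == j))); last first.
    by move=> k _; rewrite -exprD.
  rewrite [RHS]big_split/=; congr (_ * _).
  rewrite (bigD1 j)//= eqxx expr1 big1 ?mulr1// => k /negbTE ->.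
  by rewrite expr0.
rewrite esymE mulr_sumr.
rewrite (reindex_onto (fun p : {set 'I_n} * 'I_n => ((p.1 :\ p.2)%SET, p.2))
  (fun p : {set 'I_n} * 'I_n => ((p.2 |: p.1)%SET, p.2))); last first.
  by move=> [A j] /= /andP[_ jA]; rewrite finset.setU1K.
rewrite (eq_bigl (fun p : {set 'I_n} * 'I_n => (#|p.1| == d.+1) && (p.2 \in p.1))); last first.
  move=> [B j] /=; rewrite !inE eqxx /= !andbT xpair_eqE eqxx andbT.
  have [jB|jB] := boolP (j \in B).
    by rewrite finset.setD1K// eqxx !andbT (cardsD1 j B) jB add1n eqSS.
  rewrite andbF; apply/negbTE; rewrite negb_and; apply/orP; right.
  by apply: contra jB => /eqP <-; rewrite finset.setU11.
rewrite -(pair_big_dep (fun B : {set 'I_n} => #|B| == d.+1) (fun B j => j \in B)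
  (fun B j => \prod_(i in (B :\ j)%SET) x i * x j))/=.
apply: eq_bigr => B /eqP Bd.
rewrite (eq_bigr (fun=> \prod_(i in B) x i)); last first.
  move=> j jB; rewrite [RHS](bigD1 j)//= mulrC; congr (_ * _).
  by apply: eq_bigl => i; rewrite !inE andbC.
by rewrite sumr_const Bd mulr_natl.
Qed.

Lemma card_draws_le d :
  (#|[pred p : {set 'I_n} * 'I_n | (#|p.1| == d) && (p.2 \in p.1)]| <= d * n ^ d)%N.
Proof.
rewrite -sum1_card.
rewrite -(pair_big_dep (fun B : {set 'I_n} => #|B| == d) (fun B j => j \in B) (fun _ _ => 1%N))/=.
rewrite (eq_bigr (fun=> d)); last by move=> B /eqP Bd; rewrite sum1_card.
rewrite sum_nat_const mulnC leq_mul2l; apply/orP; right.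
have -> : #|[pred B : {set 'I_n} | #|B| == d]| = 'C(n, d).
  by rewrite -[in RHS](card_ord n) -card_draws cardsE.
have : (n ^_ d <= n ^ d)%N.
  elim: d => [|d IH]; first by rewrite ffactn0.
  by rewrite ffactnSr expnSr leq_mul// leq_subr.
by rewrite -bin_ffact; apply: leq_trans; rewrite leq_pmulr// fact_gt0.
Qed.

End ElementarySymmetric.

Section EsymWalk.
Context (R : realType) (n N : nat) (w : R[i]) (z : 'I_n -> R[i]).
Hypotheses (n0 : (0 < n)%N) (N1 : (1 < N)%N) (w_prim : N.+1.-primitive_root w).
Hypothesis z1 : unimodular z.
Local Notation G := {ffun 'I_n -> 'I_N.+1}.
Local Notation zt := (fun g : G => zeta w z g).
Local Notation rho := (Num.sqrt n%:R : R).

Lemma mean_orthonormal_sqr (I : finType) (P : pred I) (a : I -> 'I_n -> nat) :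
  (forall i k, P i -> (a i k <= N)%N) ->
  (forall i i', P i -> P i' -> i != i' -> exists k, a i k != a i' k) ->
  mean (fun g => cabs (\sum_(i | P i) mono (a i) (zt g)) ^+ 2) = #|P|%:R.
Proof.
move=> aN ainj; apply: (@complexI R).
rewrite mean_complex (eq_mean (g := fun g => \sum_(i | P i) \sum_(i' | P i')
  (mono (a i) (zt g) * (mono (a i') (zt g))^*))); last first.
  move=> g; rewrite -mulr_conj rmorph_sum mulr_suml; apply: eq_bigr => i _.
  by rewrite mulr_sumr.
rewrite mean_sum rmorph_nat -sum1_card natr_sum; apply: eq_bigr => i Pi.
rewrite mean_sum (bigD1 i)//= (mean_mono_norm w_prim)// big1 ?addr0// => i' /andP[Pi' ii'].
have [k ak] := ainj i i' Pi Pi' (ltac:(by rewrite eq_sym)).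
by apply: (@mean_mono_eq0 R n N w w_prim (a i) (a i') z k); rewrite ?aN.
Qed.

(** The exponents determine the pair, its index being the only coordinate with exponent 2; so the
    squared norm counts the pairs. The rest has order n^(d/2), a factor n^(1/2) below e_(d+1). *)
Lemma mean_esym_rest d :
  mean (fun g => cabs (esym_rest d (zt g)) ^+ 2) <= d%:R * (rho ^+ d) ^+ 2.
Proof.
rewrite mean_orthonormal_sqr.
- rewrite -exprM mulnC exprM sqr_sqrtr ?ler0n// -natrX -natrM ler_nat.
  exact: card_draws_le.
- move=> [A j] k _ /=; apply: leq_trans N1.
  by case: (k \in A); case: (k == j).
- move=> [A j] [A' j'] /= /andP[_ jA] /andP[_ jA'] ne.
  have [jj|jj] := eqVneq j j'; last first.
    exists j; rewrite eqxx (negbTE jj) jA addn0.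
    by case: (j \in A').
  rewrite -jj xpair_eqE eqxx andbT in ne.
  have [k kA] : exists k, (k \in A) != (k \in A').
    apply/existsP; rewrite -negb_forall; apply: contra ne => /forallP h.
    by apply/eqP/setP => k; exact/eqP.
  exists k; rewrite -jj eqn_add2r.
  by case: (k \in A) (k \in A') kA => [] [].
Qed.

Lemma sum_zeta_walk (g : G) : \sum_i zeta w z g i = rho%:C * walk w z n g.
Proof.
rewrite /walk mulrA -rmorphM divff; last by rewrite gt_eqF// sqrtr_gt0 ltr0n.
by rewrite mul1r; apply: eq_bigl => i; rewrite ltn_ord.
Qed.

End EsymWalk.

(** * Comparison of d! e_d with the power of the sum *)

Section EsymPower.
Context (R : realType).

Definition esym_defect n d (x : 'I_n -> R[i]) : R[i] :=
  d`!%:R * esym d x - (\sum_i x i) ^+ d.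

Lemma esym_defectS n d (x : 'I_n -> R[i]) :
  esym_defect d.+1 x = (\sum_i x i) * esym_defect d x - d`!%:R * esym_rest d x.
Proof.
have := esym_rec d x; rewrite /esym_defect factS natrM exprS => h.
have -> : esym_rest d x = (\sum_i x i) * esym d x - d.+1%:R * esym d.+1 x.
  by rewrite h addrAC subrr add0r.
ring.
Qed.

(* The weight [cabs (walk w z n g) ^+ M] makes the statement inductive:
   [esym_defectS] multiplies the previous defect by the walk. *)
Lemma mean_esym_defect d M : exists2 C : R, 0 <= C &
  forall n N (w : R[i]) (z : 'I_n -> R[i]),
    (0 < n)%N -> (1 < N)%N -> N.+1.-primitive_root w -> unimodular z ->
    mean (fun g : {ffun 'I_n -> 'I_N.+1} =>
      cabs (esym_defect d (zeta w z g)) * cabs (walk w z n g) ^+ M) <=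
    C * Num.sqrt n%:R ^+ d / Num.sqrt n%:R.
Proof.
elim: d M => [|d IH] M.
  exists 0 => // n N w z n0 N1 w_prim z1.
  rewrite (eq_mean (g := fun=> 0)) ?mean_const ?card_torus_gt0 ?mul0r// => g.
  by rewrite /esym_defect esym0 expr0 fact0 mulr1 subrr cabs0 mul0r.
have [C C0 hC] := IH M.+1; have K0 : 0 <= moment_bound R (M * 2).
  by rewrite !mulr_ge0 ?exprn_ge0 ?ler0n ?expR_ge0.
(* Cauchy-Schwarz separates the rest from the weight, whence the moment of order 2M; a sum of the
   two bounds dominates the square root of their product. *)
exists (C + d`!%:R * (d%:R + moment_bound R (M * 2))).
  by rewrite addr_ge0// mulr_ge0 ?addr_ge0 ?ler0n.
move=> n N w z n0 N1 w_prim z1.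
set rho := Num.sqrt n%:R.
have rho0 : 0 < rho by rewrite sqrtr_gt0 ltr0n.
set S := fun g : {ffun 'I_n -> 'I_N.+1} => cabs (walk w z n g).
pose D (g : {ffun 'I_n -> 'I_N.+1}) := cabs (esym_defect d (zeta w z g)).
pose Q (g : {ffun 'I_n -> 'I_N.+1}) := cabs (esym_rest d (zeta w z g)).
apply: (@le_trans _ _ (rho * mean (fun g => D g * S g ^+ M.+1) +
   d`!%:R * mean (fun g => Q g * S g ^+ M))).
  rewrite -!meanZ -meanD; apply: ler_mean => g.
  rewrite esym_defectS sum_zeta_walk//.
  apply: (@le_trans _ _ ((rho * S g * D g + d`!%:R * Q g) * S g ^+ M)).
    rewrite ler_wpM2r ?exprn_ge0 ?cabs_ge0//; apply: le_trans (cabsD _ _) _.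
    rewrite cabsN (cabsM (_ * _)) (cabsM _%:C) (cabsM d`!%:R) cabs_real gtr0_norm// lerD2l.
    by rewrite cabs_nat.
  by rewrite exprS le_eqVlt; apply/orP; left; apply/eqP; ring.
have -> : (C + d`!%:R * (d%:R + moment_bound R (M * 2))) * rho ^+ d.+1 / rho =
  rho * (C * rho ^+ d / rho) + d`!%:R * (rho ^+ d * (d%:R + moment_bound R (M * 2))).
  by rewrite exprS; field; rewrite gt_eqF.
rewrite lerD ?ler_wpM2l ?ler0n ?(ltW rho0)//; first exact: hC.
have rd0 : 0 <= rho ^+ d by rewrite exprn_ge0// ltW.
rewrite -ler_sqr ?nnegrE; last 2 first.
- by apply: mean_ge0 => g; rewrite mulr_ge0 ?exprn_ge0 ?cabs_ge0.
- by rewrite mulr_ge0// addr_ge0 ?ler0n.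
apply: le_trans (mean_CauchySchwarz _ _) _.
apply: (@le_trans _ _ (d%:R * (rho ^+ d) ^+ 2 * moment_bound R (M * 2))).
  rewrite ler_pM//.
  - by apply: mean_ge0 => g; exact: sqr_ge0.
  - by apply: mean_ge0 => g; exact: sqr_ge0.
  - exact: mean_esym_rest.
  - rewrite (eq_mean (g := fun g => S g ^+ (M * 2))) ?moment_walk// => g.
    by rewrite exprM.
rewrite exprMn mulrAC [leRHS]mulrC ler_wpM2r ?sqr_ge0//.
have := ler0n R d; move: (moment_bound _ _) K0 (d%:R) => a a0 b b0; nra.
Qed.

Lemma mean_esym_walk d : exists2 C : R, 0 <= C &
  forall n N (w : R[i]) (z : 'I_n -> R[i]),
    (0 < n)%N -> (1 < N)%N -> N.+1.-primitive_root w -> unimodular z ->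
    `|d`!%:R * mean (fun g : {ffun 'I_n -> 'I_N.+1} => cabs (esym d (zeta w z g)))
      / Num.sqrt n%:R ^+ d
    - mean (fun g : {ffun 'I_n -> 'I_N.+1} => cabs (walk w z n g) ^+ d)| <=
    C / Num.sqrt n%:R.
Proof.
have [C C0 hC] := mean_esym_defect d 0; exists C => // n N w z n0 N1 w_prim z1.
set rho := Num.sqrt n%:R; have rho0 : 0 < rho by rewrite sqrtr_gt0 ltr0n.
have rd0 : 0 < rho ^+ d by rewrite exprn_gt0.
rewrite -(ler_pM2r rd0) -[X in _ * X <= _]gtr0_norm// -normrM mulrBl mulfVK ?gt_eqF//.
rewrite [X in _ - X]mulrC -!meanZ -meanB.
apply: le_trans (_ : mean (fun g : {ffun 'I_n -> 'I_N.+1} =>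
   cabs (esym_defect d (zeta w z g))) <= _); last first.
  have := hC n N w z n0 N1 w_prim z1; rewrite mulrAC.
  by apply: le_trans; apply: ler_mean => g; rewrite expr0 mulr1.
have h (g : {ffun 'I_n -> 'I_N.+1}) : `|d`!%:R * cabs (esym d (zeta w z g)) -
    rho ^+ d * cabs (walk w z n g) ^+ d| <= cabs (esym_defect d (zeta w z g)).
  apply: le_trans (lerB_cabs _ _).
  rewrite sum_zeta_walk// cabsX (cabsM _%:C) (cabsM d`!%:R) cabs_real (gtr0_norm rho0) exprMn.
  by rewrite cabs_nat.
rewrite ler_norml; apply/andP; split.
  by rewrite -meanN; apply: ler_mean => g; have := h g; rewrite ler_norml => /andP[].
by apply: ler_mean => g; exact: le_trans (ler_norm _) (h g).
Qed.

End EsymPower.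

(** * Weierstrass approximation *)

Section Bernstein.
Context (R : realType).
Implicit Types (h : nat -> R) (y : R).

(** The de Casteljau recursion: at [y] the value is the expectation of h (k + B) for B binomial with
    parameters m and y. No binomial sum is then needed for positivity or variance. *)
Fixpoint bernstein h m k : {poly R} :=
  if m is m'.+1 then 'X * bernstein h m' k.+1 + (1 - 'X) * bernstein h m' k
  else (h k)%:P.

Lemma bernsteinS h m k y : (bernstein h m.+1 k).[y] =
  y * (bernstein h m k.+1).[y] + (1 - y) * (bernstein h m k).[y].
Proof. by rewrite /= !hornerE. Qed.

Lemma bernstein_le h h' m k y : 0 <= y <= 1 -> (forall i, h i <= h' i) ->
  (bernstein h m k).[y] <= (bernstein h' m k).[y].
Proof.
move=> /andP[y0 y1] hh; elim: m k => [|m IH] k; first by rewrite /= !hornerC.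
by rewrite !bernsteinS lerD// ler_wpM2l// subr_ge0.
Qed.

Lemma bernstein_quadratic (a b c : R) m k y :
  (bernstein (fun i => a + b * (i%:R - c) ^+ 2) m k).[y] =
  a + b * ((k%:R + m%:R * y - c) ^+ 2 + m%:R * (y * (1 - y))).
Proof.
elim: m k => [|m IH] k; first by rewrite /= hornerC; ring.
by rewrite bernsteinS !IH -(natr1 m) -(natr1 k); ring.
Qed.

(** The modulus of continuity is stated with a quadratic term because the expectation of that term
    is the binomial variance, as in Chebyshev's inequality. *)
Lemma bernstein_approx (g : R -> R) :
  (forall e : R, 0 < e -> exists2 B : R, 0 <= B &
    forall x y, `|g x - g y| <= e + B * (x - y) ^+ 2) ->
  forall e : R, 0 < e -> exists p : {poly R},
    forall y, 0 <= y <= 1 -> `|g y - p.[y]| <= e.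
Proof.
move=> hg e e0; have e2 : 0 < e / 2 by lra.
have [B B0 hB] := hg _ e2.
pose m := (Num.truncn (2 * B / e)).+1.
have m0 : 0 < m%:R :> R by rewrite ltr0n.
have mB : B / m%:R <= e / 2.
  rewrite ler_pdivrMr//; have := truncnS_gt (2 * B / e); rewrite -/m ltr_pdivrMr//.
  by move=> h; lra.
pose h k : R := g (k%:R / m%:R).
exists (bernstein h m 0) => y yI; have /andP[y0 y1] := yI.
have q k : `|h k - g y| <= e / 2 + B / m%:R ^+ 2 * (k%:R - m%:R * y) ^+ 2.
  apply: le_trans (hB _ _) _; rewrite lerD2l le_eqVlt; apply/orP; left; apply/eqP.
  by field; rewrite gt_eqF.
have v : e / 2 + B / m%:R ^+ 2 * (m%:R * (y * (1 - y))) <= e.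
  have -> : B / m%:R ^+ 2 * (m%:R * (y * (1 - y))) = B / m%:R * (y * (1 - y)).
    by field; rewrite gt_eqF.
  have : B / m%:R * (y * (1 - y)) <= B / m%:R.
    rewrite ler_piMr ?divr_ge0 ?(ltW m0)//.
    by apply: mulr_ile1; rewrite ?subr_ge0 ?gerBl.
  by lra.
have up : (bernstein h m 0).[y] <= g y + e.
  apply: le_trans (bernstein_le (h' := fun k => g y + e / 2 + B / m%:R ^+ 2 * (k%:R - m%:R * y) ^+ 2) _ _ yI _) _.
    by move=> k; have := q k; rewrite ler_norml => /andP[_]; lra.
  by rewrite bernstein_quadratic; have -> : 0%:R + m%:R * y - m%:R * y = 0 :> R; [ring|rewrite expr0n/= add0r; lra].
have lo : g y - e <= (bernstein h m 0).[y].
  apply: le_trans (bernstein_le (h := fun k => g y - e / 2 + (- (B / m%:R ^+ 2)) * (k%:R - m%:R * y) ^+ 2) _ _ yI _).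
    by rewrite bernstein_quadratic; have -> : 0%:R + m%:R * y - m%:R * y = 0 :> R; [ring|rewrite expr0n/= add0r; lra].
  by move=> k; have := q k; rewrite ler_norml => /andP[+ _]; lra.
by rewrite ler_norml; apply/andP; split; lra.
Qed.

End Bernstein.

(** * Approximation of r^d by polynomials in exp (- r^2) *)

Section PowerApprox.
Context (R : realType).
Implicit Types (x y r : R).

(* With [ln_max_lipschitz], gives an explicit modulus of continuity for
   [trunc_root], avoiding any compactness argument. *)
Lemma sqrt_holder (x y : R) : (Num.sqrt x - Num.sqrt y) ^+ 2 <= `|x - y|.
Proof.
wlog xy : x y / y <= x.
  move=> h; have [yx|/ltW xy] := leP y x; first exact: h.
  by rewrite -sqrrN opprB distrC; exact: h.
rewrite ger0_norm ?subr_ge0//.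
have [x0|x0] := leP x 0.
  by rewrite !ler0_sqrtr ?(le_trans xy)// subrr expr0n subr_ge0.
have [y0|/ltW y0] := leP y 0.
  by rewrite (ler0_sqrtr y0) subr0 sqr_sqrtr ?(ltW x0)//; lra.
have := sqr_sqrtr y0; have := sqr_sqrtr (ltW x0).
have := sqrtr_ge0 y; have := ler_wsqrtr xy.
move: (Num.sqrt x) (Num.sqrt y) => a b ba b0 ax bY; nra.
Qed.

Lemma ln_max_lipschitz (c x y : R) : 0 < c ->
  `|ln (Num.max x c) - ln (Num.max y c)| <= `|x - y| / c.
Proof.
move=> c0; wlog xy : x y / y <= x.
  move=> h; have [yx|/ltW xy] := leP y x; first exact: h.
  by rewrite distrC [`|x - y|]distrC; exact: h.
set a := Num.max x c; set b := Num.max y c.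
have b0 : 0 < b by rewrite lt_max c0 orbT.
have ab : b <= a by rewrite /a /b ge_max !le_max xy lexx orbT.
have cb : c <= b by rewrite le_max lexx orbT.
have a0 : 0 < a by exact: lt_le_trans ab.
have abxy : a - b <= x - y.
  by rewrite /a /b; case: (leP x c); case: (leP y c); lra.
rewrite -ln_div ?posrE// !ger0_norm ?subr_ge0//; last first.
  by rewrite ln_ge0// ler_pdivlMr// mul1r.
have -> : a / b = 1 + (a - b) / b by field; rewrite gt_eqF.
have q0 : 0 <= (a - b) / b by rewrite divr_ge0 ?subr_ge0// ltW.
apply: le_trans (le_ln1Dx _) _; first by lra.
by rewrite ler_pM ?subr_ge0 ?invr_ge0 ?(ltW b0)// lef_pV2 ?posrE.
Qed.

Lemma exprB_le (d : nat) (L a b : R) : 0 <= a <= L -> 0 <= b <= L ->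
  `|a ^+ d - b ^+ d| <= d%:R * L ^+ d.-1 * `|a - b|.
Proof.
move=> /andP[a0 aL] /andP[b0 bL]; have L0 := le_trans a0 aL.
elim: d => [|d IH]; first by rewrite !expr0 subrr normr0 !mul0r.
have -> : a ^+ d.+1 - b ^+ d.+1 = (a - b) * a ^+ d + b * (a ^+ d - b ^+ d).
  by rewrite !exprS; ring.
rewrite (le_trans (ler_normD _ _))// !normrM -natr1 mulrDl mul1r mulrDl addrC.
apply: lerD; last first.
  by rewrite mulrC ler_wpM2r// ger0_norm ?exprn_ge0// lerXn2r ?nnegrE.
rewrite (ger0_norm b0); apply: le_trans (ler_pM _ _ bL IH) _ => //.
case: d {IH} => [|d]; first by rewrite !mul0r mulr0.
by rewrite /= [in leRHS]exprS le_eqVlt; apply/orP; left; apply/eqP; ring.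
Qed.

(* [min r L] as a continuous function of [y = exp (- r^2)]. *)
Definition trunc_root (L y : R) : R := Num.sqrt (- ln (Num.max y (expR (- L ^+ 2)))).

Lemma trunc_root_le (L y : R) : 0 <= L -> 0 <= trunc_root L y <= L.
Proof.
move=> L0; rewrite sqrtr_ge0/= -[leRHS]ger0_norm// -sqrtr_sqr ler_wsqrtr// lerNl.
rewrite -[leLHS]expRK ler_ln ?posrE ?expR_gt0 ?lt_max ?expR_gt0 ?orbT//.
by rewrite le_max lexx orbT.
Qed.

Lemma trunc_rootE (L r : R) : 0 <= L -> 0 <= r ->
  trunc_root L (expR (- r ^+ 2)) = Num.min r L.
Proof.
move=> L0 r0; rewrite /trunc_root.
have -> : Num.max (expR (- r ^+ 2)) (expR (- L ^+ 2)) = expR (- (Num.min r L) ^+ 2).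
  have [rL|/ltW Lr] := leP r L; [rewrite max_l//|rewrite max_r//];
  by rewrite ler_expR lerN2 lerXn2r ?nnegrE.
by rewrite expRK opprK sqrtr_sqr ger0_norm// le_min r0.
Qed.

Lemma trunc_root_modulus (d : nat) (L : R) : 0 <= L ->
  forall e : R, 0 < e -> exists2 B : R, 0 <= B &
    forall x y, `|trunc_root L x ^+ d - trunc_root L y ^+ d| <= e + B * (x - y) ^+ 2.
Proof.
move=> L0 e e0; pose D := d%:R * L ^+ d.-1.
have D0 : 0 <= D by rewrite mulr_ge0 ?ler0n ?exprn_ge0.
pose c := expR (- L ^+ 2); have c0 : 0 < c by exact: expR_gt0.
pose K := D ^+ 2 / (2 * e * c).
have K0 : 0 <= K by rewrite divr_ge0 ?sqr_ge0// !mulr_ge0// ltW.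
exists (K ^+ 2 / (2 * e)); first by rewrite divr_ge0 ?sqr_ge0// mulr_ge0// ltW.
move=> x y; set a := trunc_root L x; set b := trunc_root L y.
have h1 : `|a ^+ d - b ^+ d| <= D * `|a - b|.
  by apply: exprB_le; exact: trunc_root_le.
have h2 : `|a - b| ^+ 2 <= `|x - y| / c.
  rewrite real_normK ?num_real//; apply: le_trans (sqrt_holder _ _) _.
  by rewrite -opprD normrN ln_max_lipschitz.
(* Two uses turn the Hölder bound of exponent 1/2 into the quadratic modulus: the first squares |a -
   b|, the second squares |x - y|. *)
have h3 (u v : R) : u * v <= e / 2 + u ^+ 2 * v ^+ 2 / (2 * e).
  rewrite -subr_ge0 (_ : _ - _ = (u * v - e) ^+ 2 / (2 * e)).
    by rewrite divr_ge0 ?sqr_ge0// mulr_ge0// ltW.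
  by field; rewrite gt_eqF.
apply: le_trans h1 _; apply: le_trans (h3 _ _) _.
have h4 : D ^+ 2 * `|a - b| ^+ 2 / (2 * e) <= K * `|x - y|.
  have -> : K * `|x - y| = D ^+ 2 * (`|x - y| / c) / (2 * e).
    by rewrite /K; field; rewrite !gt_eqF.
  rewrite ler_wpM2r ?invr_ge0 ?mulr_ge0 ?(ltW e0)//.
  by rewrite ler_wpM2l ?sqr_ge0.
have h5 := h3 K `|x - y|; rewrite real_normK ?num_real// in h5.
have -> : K ^+ 2 / (2 * e) * (x - y) ^+ 2 = K ^+ 2 * (x - y) ^+ 2 / (2 * e) by ring.
set X := K ^+ 2 * (x - y) ^+ 2 / (2 * e) in h5 *.
have -> : e + X = e / 2 + (e / 2 + X) by field.
by rewrite lerD2l; exact: le_trans h4 h5.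
Qed.

(** Truncation at height 1/e costs at most r^d, which beyond that height is at most e r^(d+1). *)
Lemma power_approx (d : nat) (e : R) : 0 < e -> exists p : {poly R},
  forall r, 0 <= r -> `|r ^+ d - p.[expR (- r ^+ 2)]| <= e * (1 + r ^+ d.+1).
Proof.
move=> e0; have L0 : 0 < e^-1 by rewrite invr_gt0.
have [p hp] := bernstein_approx (trunc_root_modulus d (ltW L0)) e0.
exists p => r r0.
have yI : 0 <= expR (- r ^+ 2) <= 1.
  by rewrite expR_ge0 -expR0 ler_expR oppr_le0 sqr_ge0.
have := hp _ yI; rewrite trunc_rootE ?(ltW L0)// => h.
apply: le_trans (ler_distD (Num.min r e^-1 ^+ d) _ _) _.
rewrite mulrDr mulr1 addrC lerD//.
have rd0 : 0 <= r ^+ d by rewrite exprn_ge0.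
have [rL|Lr] := leP r e^-1.
  by rewrite subrr normr0 mulr_ge0 ?(ltW e0)// exprn_ge0.
rewrite ger0_norm; last by rewrite subr_ge0 lerXn2r ?nnegrE ?(ltW L0)// ltW.
have -> : e * r ^+ d.+1 = (e * r) * r ^+ d by rewrite exprS; ring.
apply: (@le_trans _ _ (r ^+ d)); first by rewrite gerBl exprn_ge0// ltW.
by rewrite ler_peMl// -(divff (lt0r_neq0 e0)) ler_wpM2l// ltW.
Qed.

End PowerApprox.

(** * The Gamma integral *)

Section GammaIntegral.
Context (R : realType).
Local Notation mu := (@lebesgue_measure R).
Local Notation D := (`]0%R, +oo[%classic : set R).

Let mD : measurable D. Proof. exact: measurable_itv. Qed.

Let iZ (k : R) (f : R -> \bar R) :
  mu.-integrable D f -> mu.-integrable D (fun x => (k%:E * f x)%E).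
Proof. exact: integrableZl. Qed.

Let iD (f g : R -> R) : mu.-integrable D (EFin \o f) -> mu.-integrable D (EFin \o g) ->
  mu.-integrable D (EFin \o (fun x => f x + g x)).
Proof.
move=> hf hg; have := @integrableD _ _ _ mu D mD _ _ hf hg.
by apply: eq_integrable.
Qed.

Let iB (f g : R -> R) : mu.-integrable D (EFin \o f) -> mu.-integrable D (EFin \o g) ->
  mu.-integrable D (EFin \o (fun x => f x - g x)).
Proof.
move=> hf hg; have := @integrableB _ _ _ mu D mD _ _ hf hg.
by apply: eq_integrable.
Qed.

Lemma integrable_expRN (c : R) : 0 < c ->
  mu.-integrable D (EFin \o (fun t => expR (- (c * t)))).
Proof.
move=> c0.
have := @integrableS _ _ _ mu _ _ _ measurableT mD (@subsetT _ _) (integrable_exponential_pdf c0).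
move=> h; have := iZ c^-1 h; apply: eq_integrable => // t.
rewrite inE/= in_itv/= andbT => t0.
rewrite /exponential_pdf patchE mem_set ?in_itv/= ?in_itv/= ?ltW//.
by rewrite -EFinM mulrA mulVf ?gt_eqF// mul1r mulNr.
Qed.

Lemma Rintegral_expRN (c : R) : 0 < c ->
  Rintegral mu D (fun t => expR (- (c * t))) = c^-1.
Proof.
move=> c0; have h := integral_exponential_pdf c0.
have : Rintegral mu D (fun t => c * expR (- (c * t))) = 1.
  rewrite Rintegral_itv_obnd_cbnd; last exact: (iZ c (integrable_expRN c0)).
  rewrite Rintegral_mkcond /Rintegral.
  rewrite (_ : (fun t => _) = fun t => (exponential_pdf c t)%:E) ?h//.
  apply/funext => t; congr EFin; rewrite /exponential_pdf !patchE.
  by case: ifP => // _; rewrite mulNr.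
rewrite RintegralZl//; last exact: integrable_expRN.
by move=> E; apply: (mulfI (lt0r_neq0 c0)); rewrite E divff// gt_eqF.
Qed.

(** The dominating function is a multiple of exp (- t / 2), from r^M <= M! exp r and sqrt t <= 1/2 +
    t/2. *)
Lemma integrable_power (M : nat) :
  mu.-integrable D (EFin \o (fun t => Num.sqrt t ^+ M * expR (- t))).
Proof.
have half0 : 0 < 1 / 2 :> R by lra.
have := iZ (M`!%:R * expR (1 / 2)) (integrable_expRN half0).
apply: le_integrable => //.
  apply/measurable_EFinP/measurable_funTS/measurable_funM; last first.
    by apply: measurableT_comp => //; exact: measurableT_comp.
  apply: measurable_funX; apply: continuous_measurable_fun; exact: sqrt_continuous.
move=> t; rewrite /= in_itv/= andbT => t0; rewrite lee_fin.
rewrite !ger0_norm ?mulr_ge0 ?exprn_ge0 ?expR_ge0 ?sqrtr_ge0 ?ler0n//.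
have -> : expR (- t) = expR (- (t / 2)) * expR (- (1 / 2 * t)).
  by rewrite -expRD; congr expR; field.
rewrite mulrA ler_wpM2r ?expR_ge0//.
apply: le_trans (ler_wpM2r (expR_ge0 _) (exprn_le_expR M (sqrtr_ge0 t))) _.
rewrite -mulrA ler_wpM2l ?ler0n// -expRD ler_expR.
by have := sqr_ge0 (Num.sqrt t - 1); rewrite sqrrB sqr_sqrtr ?(ltW t0)//; lra.
Qed.

(** The integral of p over [0, 1], that is, of p (exp (- t)) exp (- t) over the half-line. *)
Definition poly_int (p : {poly R}) : R := \sum_(k < size p) p`_k / k.+1%:R.

Lemma integral_exp_sum (a : nat -> R) m :
  mu.-integrable D (EFin \o (fun t => \sum_(k < m) a k * expR (- (k.+1%:R * t)))) /\
  Rintegral mu D (fun t => \sum_(k < m) a k * expR (- (k.+1%:R * t))) =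
    \sum_(k < m) a k / k.+1%:R.
Proof.
elim: m => [|m [IH1 IH2]].
  split.
    rewrite (_ : _ \o _ = cst 0%E); first exact: integrable0.
    by apply/funext => t /=; rewrite big_ord0.
  rewrite big_ord0; transitivity (Rintegral mu D (fun=> 0)).
    by apply: eq_Rintegral => t _; rewrite big_ord0.
  by rewrite Rintegral_cst// mul0r.
have i1 : mu.-integrable D (EFin \o (fun t => expR (- (m.+1%:R * t)))).
  by apply: integrable_expRN; rewrite ltr0n.
have i2 : mu.-integrable D (EFin \o (fun t => a m * expR (- (m.+1%:R * t)))).
  exact: (iZ (a m) i1).
have E : (fun t : R => \sum_(k < m.+1) a k * expR (- (k.+1%:R * t))) =
  (fun t => \sum_(k < m) a k * expR (- (k.+1%:R * t)) + a m * expR (- (m.+1%:R * t))).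
  by apply/funext => t; rewrite big_ord_recr.
rewrite E; split; first exact: iD.
rewrite RintegralD// IH2 big_ord_recr/= RintegralZl// Rintegral_expRN//.
Qed.

Definition gamma_half (d : nat) : R :=
  Rintegral mu D (fun t => Num.sqrt t ^+ d * expR (- t)).

Lemma Gamma_half d : Gamma (1 + d%:R / 2) = gamma_half d.
Proof.
apply: eq_Rintegral => t; rewrite inE/= in_itv/= andbT => t0; congr (_ * _).
by rewrite addrAC subrr add0r mulrC powRrM powR12_sqrt ?(ltW t0)// powR_mulrn ?sqrtr_ge0.
Qed.

(** The same polynomial that approximates the moment of the walk is integrated against exp (- t) at
    r = sqrt t, so both sides are compared with [poly_int p]. *)
Lemma gamma_half_approx (d : nat) (p : {poly R}) (e : R) :
  (forall r, 0 <= r -> `|r ^+ d - p.[expR (- r ^+ 2)]| <= e * (1 + r ^+ d.+1)) ->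
  `|gamma_half d - poly_int p| <= e * (1 + gamma_half d.+1).
Proof.
move=> hp; have [i1 E1] := integral_exp_sum (fun k => p`_k) (size p).
have qE t : \sum_(k < size p) p`_k * expR (- (k.+1%:R * t)) = p.[expR (- t)] * expR (- t).
  rewrite horner_coef mulr_suml; apply: eq_bigr => k _; rewrite -mulrA -exprSr.
  by rewrite -expRM_natl; congr (_ * expR _); ring.
have i0 : mu.-integrable D (EFin \o (fun t => expR (- t))).
  have := integrable_expRN (@ltr01 R).
  by apply: eq_integrable => // t _; rewrite /= mul1r.
rewrite /poly_int -E1 /gamma_half -RintegralB//; last exact: integrable_power.
have ii := iB (integrable_power d) i1.
apply: (le_trans (@le_normr_Rintegral _ _ _ mu D _ mD ii)).
have ib : mu.-integrable D (EFin \o (fun t => expR (- t) + Num.sqrt t ^+ d.+1 * expR (- t))).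
  exact: (iD i0 (integrable_power d.+1)).
apply: (@le_trans _ _ (Rintegral mu D (fun t => e * (expR (- t) + Num.sqrt t ^+ d.+1 * expR (- t))))).
  apply: le_Rintegral => //.
  - have := integrable_norm ii.
    by apply: eq_integrable.
  - exact: (iZ e ib).
  - move=> t; rewrite /= in_itv/= andbT => t0; rewrite qE -mulrBl normrM.
    rewrite [X in _ * X]ger0_norm ?expR_ge0//.
    have := hp _ (sqrtr_ge0 t); rewrite sqr_sqrtr ?(ltW t0)// => h.
    have -> : e * (expR (- t) + Num.sqrt t ^+ d.+1 * expR (- t)) =
      e * (1 + Num.sqrt t ^+ d.+1) * expR (- t) by ring.
    by rewrite ler_wpM2r ?expR_ge0.
rewrite RintegralZl// RintegralD//; last exact: integrable_power.
suff -> : Rintegral mu D (fun t => expR (- t)) = 1 by [].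
transitivity (Rintegral mu D (fun t => expR (- (1 * t)))).
  by apply: eq_Rintegral => t _; rewrite mul1r.
by rewrite Rintegral_expRN// invr1.
Qed.

End GammaIntegral.

(** * Asymptotics *)

Section Asymptotics.
Context (R : realType).

Lemma le_div_sqrt (C e : R) : 0 < e -> exists n0 : nat,
  forall n : nat, (n0 < n)%N -> C / Num.sqrt n%:R <= e.
Proof.
move=> e0; exists (Num.truncn ((C / e) ^+ 2)) => n n0n.
have n0 : (0 < n)%N by exact: leq_ltn_trans n0n.
rewrite ler_pdivrMr ?sqrtr_gt0 ?ltr0n// mulrC -ler_pdivrMr//.
apply: le_trans (ler_norm _) _; rewrite -sqrtr_sqr ler_wsqrtr// ltW//.
by apply: lt_le_trans (truncnS_gt _) _; rewrite ler_nat.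
Qed.

Definition torus_setting n N (w : R[i]) (z : 'I_n -> R[i]) :=
  [/\ (0 < n)%N, (1 < N)%N, N.+1.-primitive_root w & unimodular z].

Lemma mean_poly_walk (p : {poly R}) (e : R) : 0 < e -> exists n0 : nat,
  forall n N (w : R[i]) (z : 'I_n -> R[i]), (n0 < n)%N -> torus_setting N w z ->
  `|mean (fun g : {ffun 'I_n -> 'I_N.+1} => p.[expR (- cabs (walk w z n g) ^+ 2)])
    - poly_int p| <= e.
Proof.
move=> e0; pose K : R := 72 * expR 1 + 12.
have K0 : 0 <= K by rewrite addr_ge0 ?mulr_ge0 ?expR_ge0.
pose C : R := \sum_(k < size p) `|p`_k| * (k%:R ^+ 3 * K).
have [n1 hn1] := le_div_sqrt C e0.
have [n2 hn2] := @le_div_sqrt (size p)%:R (1 / 4) (ltac:(lra)).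
exists (maxn n1 n2) => n N w z; rewrite gtn_max => /andP[/hn1 h1 /hn2 h2].
move=> [n0 N1 w_prim z1].
have -> : mean (fun g : {ffun 'I_n -> 'I_N.+1} => p.[expR (- cabs (walk w z n g) ^+ 2)]) =
  \sum_(k < size p) p`_k * mean (fun g : {ffun 'I_n -> 'I_N.+1} =>
     expR (- (k%:R * cabs (walk w z n g) ^+ 2))).
  rewrite -(eq_bigr _ (fun k _ => meanZ _ _)) -mean_sum; apply: eq_mean => g.
  by rewrite horner_coef; apply: eq_bigr => k _; rewrite -expRM_natl mulrN.
rewrite /poly_int -sumrB; apply: le_trans h1.
rewrite /C mulr_suml; apply: le_trans (ler_norm_sum _ _ _) _; apply: ler_sum => k _.
rewrite -mulrBr normrM -mulrA ler_wpM2l//.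
(* The constant term is exact; all others have k >= 1, as [laplace_walk] requires. *)
have [->|k0] := eqVneq (k : nat) 0%N.
  rewrite (eq_mean (g := fun=> 1)) ?mean_const ?card_torus_gt0//; last first.
    by move=> g; rewrite mul0r oppr0 expR0.
  by rewrite invr1 subrr normr0 expr0n/= !mul0r.
have k1 : 1 <= k%:R :> R by rewrite ler1n lt0n.
rewrite -[k.+1%:R]natr1 [_ + 1]addrC; apply: laplace_walk => //.
apply: le_trans h2; rewrite ler_wpM2r ?invr_ge0 ?sqrtr_ge0// ler_nat.
exact: ltnW.
Qed.

Lemma mean_walk_limit (d : nat) (e : R) : 0 < e -> exists n0 : nat,
  forall n N (w : R[i]) (z : 'I_n -> R[i]), (n0 < n)%N -> torus_setting N w z ->
  `|mean (fun g : {ffun 'I_n -> 'I_N.+1} => cabs (walk w z n g) ^+ d)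
    - gamma_half R d| <= e.
Proof.
move=> e0; pose K : R := moment_bound R d.+1.
have K0 : 0 <= K by rewrite !mulr_ge0 ?exprn_ge0 ?ler0n ?expR_ge0.
have G0 : 0 <= gamma_half R d.+1.
  by apply: Rintegral_ge0 => t _; rewrite mulr_ge0 ?exprn_ge0 ?expR_ge0 ?sqrtr_ge0.
(* One tolerance keeps both approximation errors, for the walk and for the integral, below e/3. *)
pose e1 := e / (3 * (1 + K + gamma_half R d.+1)).
have S0 : 0 < 1 + K + gamma_half R d.+1 by lra.
have e10 : 0 < e1 by rewrite divr_gt0// mulr_gt0.
have [p hp] := power_approx d e10.
have hG := gamma_half_approx hp.
have e30 : 0 < e / 3 by lra.
have [n0 hn0] := mean_poly_walk p e30; exists n0 => n N w z n0n zw.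
have hM := hn0 n N w z n0n zw; case: zw => n1 N1 w_prim z1.
have hK := moment_walk n1 N1 w_prim z1 d.+1.
pose r (g : {ffun 'I_n -> 'I_N.+1}) := cabs (walk w z n g).
have hA : `|mean (fun g => r g ^+ d) - mean (fun g => p.[expR (- r g ^+ 2)])| <= e1 * (1 + K).
  rewrite -meanB.
  apply: (@le_trans _ _ (mean (fun g => e1 * (1 + r g ^+ d.+1)))); last first.
    by rewrite meanZ ler_wpM2l ?(ltW e10)// meanD mean_const ?card_torus_gt0// lerD2l.
  have h g := hp (r g) (cabs_ge0 _).
  rewrite ler_norml; apply/andP; split.
    by rewrite -meanN; apply: ler_mean => g; have := h g; rewrite ler_norml => /andP[].
  by apply: ler_mean => g; exact: le_trans (ler_norm _) (h g).
have b1 : e1 * (1 + K) <= e / 3.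
  have -> : e / 3 = e1 * (1 + K + gamma_half R d.+1) by rewrite /e1; field; rewrite gt_eqF.
  by rewrite ler_wpM2l ?(ltW e10)//; lra.
have b2 : e1 * (1 + gamma_half R d.+1) <= e / 3.
  have -> : e / 3 = e1 * (1 + K + gamma_half R d.+1) by rewrite /e1; field; rewrite gt_eqF.
  by rewrite ler_wpM2l ?(ltW e10)//; lra.
move: hA hM hG; rewrite -/r !ler_norml.
move=> /andP[? ?] /andP[? ?] /andP[? ?]; apply/andP; split; lra.
Qed.

Lemma mean_esym_limit (d : nat) (e : R) : 0 < e -> exists n0 : nat,
  forall n N (w : R[i]) (z : 'I_n -> R[i]), (n0 < n)%N -> torus_setting N w z ->
  `|mean (fun g : {ffun 'I_n -> 'I_N.+1} => cabs (esym d (zeta w z g))) / Num.sqrt n%:R ^+ d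
    - gamma_half R d / d`!%:R| <= e.
Proof.
move=> e0; have e2 : 0 < e / 2 by lra.
have [C C0 hC] := mean_esym_walk R d.
have [n1 h1] := le_div_sqrt C e2; have [n2 h2] := mean_walk_limit d e2.
exists (maxn n1 n2) => n N w z; rewrite gtn_max => /andP[/h1 {}h1 nn2] zw.
have {}h2 := h2 n N w z nn2 zw; case: zw => n0 N1 w_prim z1.
have {}hC := hC n N w z n0 N1 w_prim z1.
have f1 : 1 <= d`!%:R :> R by rewrite ler1n fact_gt0.
have f0 : 0 < d`!%:R :> R by lra.
move: h2 hC; set A := mean _; set B := mean _; set D := B / _ => h2 hC.
have -> : D - gamma_half R d / d`!%:R = (d`!%:R * B / Num.sqrt n%:R ^+ d - gamma_half R d) / d`!%:R.
  by rewrite mulrBl; congr (_ - _); rewrite /D -[d`!%:R * B / _]mulrA [d`!%:R * _]mulrC mulfK ?gt_eqF.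
rewrite normrM normfV (gtr0_norm f0) ler_pdivrMr//.
apply: (@le_trans _ _ e); last by rewrite ler_peMr// ltW.
move: h2 hC; rewrite !ler_norml => /andP[? ?] /andP[? ?]; apply/andP; split; lra.
Qed.

(** One choice of roots serves the upper bound, whereas the lower bound picks them from the gap to
    be refuted; uniformity of [mean_esym_limit] allows both at the same n. The two bounds also show
    that the constant is finite. *)
Lemma proj_const_asymptotics (d : nat) (e : R) : 0 < e -> exists n0 : nat,
  forall n : nat, (n0 < n)%N -> exists2 x : R, proj_const (tetra R n d) = x%:E &
  `|x / Num.sqrt n%:R ^+ d - gamma_half R d / d`!%:R| <= e.
Proof.
move=> e0; have [n0 h0] := mean_esym_limit d e0; exists n0 => n n0n.
have n1 : (0 < n)%N by exact: leq_ltn_trans n0n.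
set L := gamma_half R d / d`!%:R; set rd := Num.sqrt n%:R ^+ d.
have rd0 : 0 < rd by rewrite exprn_gt0// sqrtr_gt0 ltr0n.
have one1 : unimodular (fun _ : 'I_n => 1 : R[i]) by move=> i; exact: cabs1.
have up : (proj_const (tetra R n d) <= (rd * (L + e))%:E)%E.
  have [N [w [N1 w_prim _]]] := roots_dense (@ltr01 R).
  apply: (proj_const_le (ltnW N1) w_prim) => z z1.
  have := h0 n N w z n0n (And4 n1 N1 w_prim z1); rewrite ler_norml => /andP[_].
  by rewrite lerBlDr ler_pdivrMr// mulrC [e + _]addrC.
have lo : ((rd * (L - e))%:E <= proj_const (tetra R n d))%E.
  rewrite leNgt; apply/negP => lt.
  have [C XC CA] : exists2 C : R, (proj_const (tetra R n d) < C%:E)%E & C < rd * (L - e).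
    case: (proj_const _) lt => [x|//|_].
      rewrite lte_fin => xA; exists ((x + rd * (L - e)) / 2); last by lra.
      by rewrite lte_fin; lra.
    by exists (rd * (L - e) - 1); [rewrite ltNyr|lra].
  have C1 : 0 < 1 + `|C| by rewrite ltr_pwDl.
  (* The total loss k + C k is then at most a third of the gap. *)
  pose k := (rd * (L - e) - C) / (3 * (1 + `|C|)).
  have k0 : 0 < k by rewrite divr_gt0 ?mulr_gt0// subr_gt0.
  have [N [w [N1 w_prim hN]]] := proj_const_ge n d k0.
  have := hN C XC.
  have := h0 n N w _ n0n (And4 n1 N1 w_prim one1); rewrite ler_norml => /andP[+ _].
  rewrite lerBrDr ler_pdivlMr// mulrC => hm hC.
  have kC : k * (1 + `|C|) = (rd * (L - e) - C) / 3 by rewrite /k; field; rewrite gt_eqF.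
  have : C * k <= `|C| * k by rewrite ler_wpM2r ?(ltW k0)// ler_norm.
  have k0' := ltW k0.
  have hm' : rd * (L - e) <= mean (fun g : {ffun 'I_n -> 'I_N.+1} => cabs (esym d (zeta w (fun=> 1) g))).
    by apply: le_trans hm; rewrite addrC.
  move: hm' hC kC CA; set m := mean _; move: (rd * (L - e)) => A.
  move: (`|C|) => c; nra.
case: (proj_const (tetra R n d)) up lo => [x|//|//]; rewrite !lee_fin => up lo.
exists x => //; rewrite ler_norml; apply/andP; split.
  by rewrite lerBrDr ler_pdivlMr// mulrC addrC.
by rewrite lerBlDr ler_pdivrMr// mulrC [e + _]addrC.
Qed.

Lemma cvg_ffact (d : nat) : (n ^_ d)%:R / (n%:R ^+ d) @[n --> \oo] --> (1 : R).
Proof.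
elim: d => [|d IH].
  rewrite (_ : (fun n => _) = fun=> 1); first exact: cvg_cst.
  by apply/funext => n; rewrite ffactn0 expr0 divr1.
have inv0 : (fun n : nat => n%:R^-1) @ \oo --> (0 : R).
  have pos : \forall n \near \oo, 0 < n%:R :> R by exists 1%N => // n /= n0; rewrite ltr0n.
  exact: (gtr0_cvgV0 pos).2 (@cvgr_idn R).
have lin : (n - d)%:R / n%:R @[n --> \oo] --> (1 : R).
  have : (1 - d%:R * n%:R^-1) @[n --> \oo] --> (1 - d%:R * 0 : R).
    by apply: cvgB; [exact: cvg_cst|apply: cvgM; [exact: cvg_cst|exact: inv0]].
  rewrite mulr0 subr0; apply: cvg_trans; apply: near_eq_cvg.
  exists d.+1 => // n /= dn; have n0 : n%:R != 0 :> R by rewrite pnatr_eq0 -lt0n (leq_ltn_trans _ dn).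
  by rewrite natrB ?(ltnW dn)// mulrBl divff.
have : ((n ^_ d)%:R / n%:R ^+ d) * ((n - d)%:R / n%:R) @[n --> \oo] --> (1 * 1 : R).
  by apply: cvgM; [exact: IH|exact: lin].
rewrite mulr1; apply: cvg_trans; apply: near_eq_cvg.
apply: nearW => n; rewrite ffactnSr natrM exprSr invfM.
by rewrite /= mulrACA.
Qed.

Lemma cvg_sqrt_bin (d : nat) :
  Num.sqrt 'C(n, d)%:R / Num.sqrt n%:R ^+ d @[n --> \oo] --> ((Num.sqrt d`!%:R)^-1 : R).
Proof.
have f0 : 0 < d`!%:R :> R by rewrite ltr0n fact_gt0.
have h : ('C(n, d))%:R / n%:R ^+ d @[n --> \oo] --> (d`!%:R^-1 : R).
  have : (n ^_ d)%:R / n%:R ^+ d * d`!%:R^-1 @[n --> \oo] --> (1 * d`!%:R^-1 : R).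
    by apply: cvgM; [exact: cvg_ffact|exact: cvg_cst].
  rewrite mul1r; apply: cvg_trans; apply: near_eq_cvg; apply: nearW => n /=.
  by rewrite -bin_ffact natrM mulrAC mulfK ?gt_eqF.
have : Num.sqrt ('C(n, d)%:R / n%:R ^+ d) @[n --> \oo] --> (Num.sqrt d`!%:R^-1 : R).
  by apply: continuous_cvg; [exact: sqrt_continuous|exact: h].
rewrite sqrtrV ?(ltW f0)//; apply: cvg_trans; apply: near_eq_cvg; apply: nearW => n /=.
rewrite sqrtrM ?ler0n// sqrtrV ?exprn_ge0//; congr (_ / _).
rewrite -[RHS]ger0_norm ?exprn_ge0 ?sqrtr_ge0// -sqrtr_sqr -exprM mulnC exprM.
by rewrite sqr_sqrtr ?ler0n.
Qed.

(** Both normalizations are instances, with [l] equal to 1 / sqrt (d!) and to 1. Positivity of [l]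
    makes [b n] eventually positive, so the extended-real quotient is the real one. *)
Lemma cvg_proj_const (d : nat) (b : nat -> R) (l : R) : 0 < l ->
  (forall n : nat, (0 < n)%N -> 0 <= b n) ->
  b n / Num.sqrt n%:R ^+ d @[n --> \oo] --> l ->
  (proj_const (tetra R n d) / (b n)%:E)%E @[n --> \oo] -->
    (gamma_half R d / d`!%:R / l)%:E.
Proof.
move=> l0 b0 bl; set L := gamma_half R d / d`!%:R.
pose x n : R := fine (proj_const (tetra R n d)).
have xE : \forall n \near \oo, proj_const (tetra R n d) = (x n)%:E.
  have [n0 h] := proj_const_asymptotics d (@ltr01 R); exists n0.+1 => // n /= n0n.
  by have [y yE _] := h n n0n; rewrite /x yE.
have xl : x n / Num.sqrt n%:R ^+ d @[n --> \oo] --> L.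
  apply/cvgrPdist_le => e e0; have [n0 h] := proj_const_asymptotics d e0.
  exists n0.+1 => // n /= n0n; have [y yE hy] := h n n0n.
  by rewrite /x yE /= distrC.
have bpos : \forall n \near \oo, 0 < b n.
  move/cvgrPdist_lt: bl => /(_ _ l0) bl; near=> n.
  have n0 : (0 < n)%N by near: n; exists 1%N.
  have : `|l - b n / Num.sqrt n%:R ^+ d| < l by near: n.
  rewrite ltr_norml => /andP[_ h]; rewrite lt_def b0// andbT.
  by apply: contraTneq h => ->; rewrite mul0r subr0 ltxx.
have bl1 : x n / Num.sqrt n%:R ^+ d * (b n / Num.sqrt n%:R ^+ d)^-1 @[n --> \oo] --> L * l^-1.
  by apply: cvgM; [exact: xl|apply: cvgV => //; exact: lt0r_neq0].
have : (x n / b n)%:E @[n --> \oo] --> (L / l)%:E.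
  apply: cvg_EFin; first exact: nearW.
  apply: cvg_trans bl1; apply: near_eq_cvg; near=> n.
  have n0 : (0 < n)%N by near: n; exists 1%N.
  have bn : 0 < b n by near: n.
  have r0 : 0 < Num.sqrt n%:R ^+ d :> R by rewrite exprn_gt0// sqrtr_gt0 ltr0n.
  by rewrite /=; field; rewrite !gt_eqF.
apply: cvg_trans; apply: near_eq_cvg; near=> n.
have bn : 0 < b n by near: n.
have xn : proj_const (tetra R n d) = (x n)%:E by near: n.
by rewrite xn inver gt_eqF.
Unshelve. all: by end_near. Qed.

End Asymptotics.
Local Open Scope ereal_scope.

Theorem theorem2p5 (R : realType) (d : nat) :
  (fun n : nat => proj_const (tetra R n d) / (Num.sqrt 'C(n, d)%:R)%:E)
      @ \oo --> (Gamma (1 + d%:R / 2) / Num.sqrt d`!%:R)%R%:E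
  /\
  (fun n : nat => proj_const (tetra R n d) / (n%:R `^ (d%:R / 2))%R%:E)
      @ \oo --> (Gamma (1 + d%:R / 2) / d`!%:R)%R%:E.
Proof.
have f0 : (0 < d`!%:R :> R)%R by rewrite ltr0n fact_gt0.
have s0 : (0 < (Num.sqrt d`!%:R)^-1 :> R)%R by rewrite invr_gt0 sqrtr_gt0.
rewrite Gamma_half; split.
- have -> : (gamma_half R d / Num.sqrt d`!%:R =
      gamma_half R d / d`!%:R / (Num.sqrt d`!%:R)^-1)%R.
    rewrite invrK -mulrA; congr (_ * _)%R.
    have r0 : (Num.sqrt d`!%:R != 0 :> R)%R by rewrite lt0r_neq0// sqrtr_gt0.
    by rewrite -[X in (X^-1 * _)%R](sqr_sqrtr (ltW f0)) expr2 invfM mulfVK.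
  by apply: cvg_proj_const => //; exact: cvg_sqrt_bin.
- rewrite -[(gamma_half R d / _)%R]divr1.
  apply: cvg_proj_const => //.
  apply: cvg_trans (@cvg_cst _ (1 : R)%R _ \oo _); apply: near_eq_cvg.
  exists 1%N => // n /= n0.
  rewrite [(d%:R / 2)%R]mulrC powRrM powR12_sqrt ?ler0n// powR_mulrn ?sqrtr_ge0//.
  by rewrite divff// lt0r_neq0// exprn_gt0// sqrtr_gt0 ltr0n.
Qed.
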